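(* For each $\star\in\{a,b,c,d,e,f\}$ there is a constant $K_\star>0$, independent of the geometry of the triangle, such that the following holds. Let $T=[v_1,v_2,v_3]\subset\mathbb{R}^2$ be any nondegenerate triangle with 12-split $T_{12}$, let $\mathcal{B}_\star=\{S_1,\dots,S_{39}\}$ be the corresponding basis of $\mathcal{S}^3_5(T_{12})$ defined in the context, and let $f=\sum_{i=1}^{39}c_iS_i\in\mathcal{S}^3_5(T_{12})$ with $\boldsymbol c=(c_1,\dots,c_{39})^{\mathsf T}\in\mathbb{R}^{39}$. Then $$K_\star^{-1}\|\boldsymbol c\|_\infty\le\|f\|_{L_\infty(T)}\le\|\boldsymbol c\|_\infty .$$
   Context: **12-split.** Let $v_4=\frac{v_1+v_2}2$, $v_5=\frac{v_2+v_3}2$, $v_6=\frac{v_1+v_3}2$, $v_7=\frac{v_4+v_6}2$, $v_8=\frac{v_4+v_5}2$, $v_9=\frac{v_5+v_6}2$, $v_{10}=\frac{v_1+v_2+v_3}3$. The 12-split $T_{12}$ is the triangulation of $T$ into 12 triangles obtained by drawing the segments $[v_1,v_5],[v_2,v_6],[v_3,v_4],[v_4,v_5],[v_5,v_6],[v_4,v_6]$; its vertices are $v_1,\dots,v_{10}$. $\mathcal{S}^3_5(T_{12})$ is the space of $C^3$ functions on $T$ that are polynomials of total degree at most 5 on each of the 12 triangles; it has dimension 39. **Simplex splines.** For a finite multiset $K=\{v_1^{m_1}\cdots v_{10}^{m_{10}}\}$ let $|K|=\sum m_i$ and $[K]$ its convex hull. For $x$ not on any line through two of the points $v_1,\dots,v_{10}$,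 define recursively $Q[K](x)=0$ if $\mathrm{area}([K])=0$; $Q[K](x)=\mathbf 1_{[K]}(x)\,\mathrm{area}(T)/\mathrm{area}([K])$ if $\mathrm{area}([K])\ne0$ and $|K|=3$; and $Q[K](x)=\sum_{j=1}^{10}\beta_jQ[K\setminus v_j](x)$ if $\mathrm{area}([K])\neq 0$ and $|K|>3$, where $x=\sum_j\beta_jv_j$, $\sum_j\beta_j=1$, $\beta_j=0$ whenever $m_j=0$, and $K\setminus v_j$ removes one copy of $v_j$ (the value does not depend on the choice of the $\beta_j$). On $T$ the function $Q[K]$ is extended by continuity (possible for all simplex splines used here). Write $Q_{ijklmn}:=Q[v_1^iv_2^jv_3^kv_4^lv_5^mv_6^n]$. **Symmetries.** Each permutation of $v_1,v_2,v_3$ extends to an affine map of $T$ permuting $v_1,\dots,v_{10}$; this gives a group $S_3$ of permutations $\sigma$. For scaled simplex splines, $[w_1Q[K_1],\dots,w_nQ[K_n]]_{S_3}$ denotes the set of all $w_iQ[\sigma(K_i)]$, $\sigma\in S_3$, $1\le i\le n$. **The bases.** Each of the following is a set of 39 functions which is a basis of $\mathcal{S}^3_5(T_{12})$ (the order of $S_1,\dots,S_{39}$ is immaterial): $$\begin{aligned} \mathcal{B}_a&=[\tfrac14Q_{600101},\tfrac14Q_{500201},\tfrac12Q_{410201},\tfrac12Q_{320201},Q_{141110},\tfrac12Q_{131210},\tfrac34Q_{222110},\tfrac34Q_{221210}]_{S_3},\\ \mathcal{B}_b&=[\tfrac14Q_{600101},\tfrac14Q_{500201},\tfrac12Q_{410201},\tfrac12Q_{320201},Q_{141110},\tfrac12Q_{131210},\tfrac34Q_{221111},\tfrac34Q_{221210}]_{S_3},\\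 \mathcal{B}_c&=[\tfrac14Q_{600101},\tfrac14Q_{500201},\tfrac12Q_{410201},\tfrac12Q_{320201},Q_{141110},\tfrac12Q_{131210},\tfrac34Q_{220211},\tfrac34Q_{121211}]_{S_3},\\ \mathcal{B}_d&=[\tfrac14Q_{600101},\tfrac14Q_{500201},\tfrac12Q_{410201},Q_{321200},Q_{141110},\tfrac12Q_{131210},\tfrac34Q_{222110},\tfrac14Q_{221210}]_{S_3},\\ \mathcal{B}_e&=[\tfrac14Q_{600101},\tfrac14Q_{500201},\tfrac12Q_{410201},Q_{321200},Q_{141110},\tfrac12Q_{131210},\tfrac34Q_{221111},\tfrac14Q_{221210}]_{S_3},\\ \mathcal{B}_f&=[\tfrac14Q_{600101},\tfrac14Q_{500201},\tfrac12Q_{410201},Q_{321200},Q_{141110},\tfrac12Q_{131210},\tfrac14Q_{220211},\tfrac12Q_{121211}]_{S_3}. \end{aligned}$$ *)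

(* Defs.v *)
From HB Require Import structures.
From mathcomp Require Import all_boot all_order all_algebra all_fingroup.
From mathcomp Require Import all_classical all_reals all_analysis.
Set Implicit Arguments.
Unset Strict Implicit.
Unset Printing Implicit Defensive.
Import Order.TTheory GRing.Theory Num.Theory.
Import numFieldNormedType.Exports.

Local Open Scope classical_set_scope.
Local Open Scope ring_scope.

Definition area (R : realType) (A : set (R * R)) : R :=
  fine ((lebesgue_measure \x lebesgue_measure)%E A).

Definition Linfty_norm (R : realType) (A : set (R * R)) (f : R * R -> R)
    : \bar R :=
  'N[(lebesgue_measure \x lebesgue_measure)%E]_+oo[EFin \o (f \_ A)].

(* The index i : 'I_10 stands for the vertex numbered i + 1. *)
Definition split12 (R : realType) (v1 v2 v3 : R * R) : 'I_10 -> R * R :=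
  let v4 := 2^-1 *: (v1 + v2) in
  let v5 := 2^-1 *: (v2 + v3) in
  let v6 := 2^-1 *: (v1 + v3) in
  let v7 := 2^-1 *: (v4 + v6) in
  let v8 := 2^-1 *: (v4 + v5) in
  let v9 := 2^-1 *: (v5 + v6) in
  let v10 := 3^-1 *: (v1 + v2 + v3) in
  fun i => nth 0 [:: v1; v2; v3; v4; v5; v6; v7; v8; v9; v10] i.

(* A multiset of vertices is the family of its multiplicities. *)
Definition knots : Type := {ffun 'I_10 -> nat}.

Definition knots_of_seq (m : seq nat) : knots := [ffun i : 'I_10 => nth 0%N m i].

Definition knots_size (K : knots) : nat := (\sum_i K i)%N.

Definition knots_rem (K : knots) (j : 'I_10) : knots :=
  [ffun i => (K i - (i == j))%N].

Definition knots_perm (s : {perm 'I_10}) (K : knots) : knots :=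
  [ffun i => K ((s^-1)%g i)].

Section SimplexSpline.
Context {R : realType}.
Variable v : 'I_10 -> R * R.

Definition barycentric (K : knots) (x : R * R) (beta : 'I_10 -> R) : Prop :=
  [/\ x = \sum_j beta j *: v j, \sum_j beta j = 1
    & forall j, K j = 0%N -> beta j = 0].

Definition hull (K : knots) : set (R * R) :=
  [set x | exists2 beta, barycentric K x beta & forall j, 0 <= beta j].

Definition triangle : set (R * R) := hull (knots_of_seq [:: 1; 1; 1]%N).

Definition line (a b : R * R) : set (R * R) :=
  [set x | exists t : R, x = (1 - t) *: a + t *: b].

Definition generic : set (R * R) :=
  [set x | forall i j, i != j -> ~ line (v i) (v j) x].

(* An arbitrary choice of the coefficients beta, on which the value of the
   simplex spline does not depend. *)
Definition beta_of (K : knots) (x : R * R) : 'I_10 -> R :=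
  xget (fun=> 0) [set beta | barycentric K x beta].

(* The recursion is on the degree n = |K| - 3. *)
Fixpoint simplex_spline_rec (n : nat) (K : knots) (x : R * R) : R :=
  if area (hull K) == 0 then 0 else
  if n is n'.+1 then
    \sum_j beta_of K x j * simplex_spline_rec n' (knots_rem K j) x
  else \1_(hull K) x * (area triangle / area (hull K)).

(* Meaningful at generic points only. *)
Definition simplex_spline_generic (K : knots) (x : R * R) : R :=
  simplex_spline_rec (knots_size K - 3) K x.

(* The continuous extension to the triangle T; functions on T are represented
   by functions on the plane that vanish outside T. *)
Definition simplex_spline (K : knots) : R * R -> R :=
  (fun x => lim (simplex_spline_generic K y
                   @[y --> within (triangle `&` generic) (nbhs x)])) \_ triangle.

(* The permutations of the ten vertices that are induced by an affine map
   permuting the corners v1, v2, v3. *)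
Definition symmetry (s : {perm 'I_10}) : Prop :=
  (forall i : 'I_10, (i < 3)%N -> (s i < 3)%N) /\
  exists (f : {linear (R * R)%type -> (R * R)%type}) (b : R * R),
    forall i, v (s i) = f (v i) + b.

Definition symmetric_set (g : seq (R * seq nat)) : set (R * R -> R) :=
  [set S | exists (wm : R * seq nat) (s : {perm 'I_10}),
     [/\ wm \in g, symmetry s
       & S = (fun x => wm.1 *
             simplex_spline (knots_perm s (knots_of_seq wm.2)) x)]].

End SimplexSpline.

Inductive basis_name := Ba | Bb | Bc | Bd | Be | Bf.

(* (w, [:: i; j; k; l; m; n]) stands for w Q_{ijklmn}. *)
Definition basis_generators (R : realType) (star : basis_name)
    : seq (R * seq nat) :=
  [:: (1 / 4, [:: 6; 0; 0; 1; 0; 1]%N);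
      (1 / 4, [:: 5; 0; 0; 2; 0; 1]%N);
      (1 / 2, [:: 4; 1; 0; 2; 0; 1]%N);
      match star with
      | Ba | Bb | Bc => (1 / 2, [:: 3; 2; 0; 2; 0; 1]%N)
      | Bd | Be | Bf => (1, [:: 3; 2; 1; 2; 0; 0]%N)
      end;
      (1, [:: 1; 4; 1; 1; 1; 0]%N);
      (1 / 2, [:: 1; 3; 1; 2; 1; 0]%N)]
  ++ match star with
     | Ba => [:: (3 / 4, [:: 2; 2; 2; 1; 1; 0]%N);
                 (3 / 4, [:: 2; 2; 1; 2; 1; 0]%N)]
     | Bb => [:: (3 / 4, [:: 2; 2; 1; 1; 1; 1]%N);
                 (3 / 4, [:: 2; 2; 1; 2; 1; 0]%N)]
     | Bc => [:: (3 / 4, [:: 2; 2; 0; 2; 1; 1]%N);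
                 (3 / 4, [:: 1; 2; 1; 2; 1; 1]%N)]
     | Bd => [:: (3 / 4, [:: 2; 2; 2; 1; 1; 0]%N);
                 (1 / 4, [:: 2; 2; 1; 2; 1; 0]%N)]
     | Be => [:: (3 / 4, [:: 2; 2; 1; 1; 1; 1]%N);
                 (1 / 4, [:: 2; 2; 1; 2; 1; 0]%N)]
     | Bf => [:: (1 / 4, [:: 2; 2; 0; 2; 1; 1]%N);
                 (1 / 2, [:: 1; 2; 1; 2; 1; 1]%N)]
     end.

Definition spline_basis (R : realType) (star : basis_name) (v1 v2 v3 : R * R)
    : set (R * R -> R) :=
  symmetric_set (split12 v1 v2 v3) (basis_generators R star).

(* Main.v *)
Require Import Defs.
From Stdlib Require Import BinInt.
From HB Require Import structures.
From mathcomp Require Import all_boot all_order all_algebra fingroup perm.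
From mathcomp Require Import all_classical all_reals all_analysis.
From mathcomp Require Import measurable_realfun ess_sup_inf lra ring zify ssrZ.
Import Order.TTheory GRing.Theory Num.Theory.
Import numFieldNormedType.Exports.

Local Open Scope classical_set_scope.
Local Open Scope ring_scope.
Set Implicit Arguments.
Unset Strict Implicit.
Unset Printing Implicit Defensive.

(** All knots of the basis functions lie among v1, ..., v6, and the lines
through two of these six points are the nine lines that cut T into the twelve
cells of the split. In barycentric coordinates with respect to v1, v2, v3 the
six points, the nine lines and the ratios of areas do not depend on T. Hence on
each open cell every basis function is a polynomial in the barycentric
coordinates, with rational coefficients independent of T, and the theorem
reduces to facts about twelve explicit integer tables.

On a cell the spline with knots K is computed by [value]: at each step the
point is expressed through three affinely independent knots whose triangle
contains the cell; without such knots the value is 0. The definition allows any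
barycentric coordinates with respect to K instead. Both give the same number
because there is a linear form u with Q[K \ v_j](x) = u(v_j) for every knot v_j
([gradient_exists]); up to a factor u is the gradient of Q[K], made homogeneous.
If x = sum_i beta_i v_i, then u = sum_i beta_i u_i works, where u_i is the form
for K \ v_i, because u_i(v_j) = Q[K \ v_i \ v_j](x) = u_j(v_i).
The induction starts with four
knots, where finitely many integer identities remain. [simplex_value] carries
this over to the recursive definition; it needs the ratio of the areas of two
triangles, hence the behaviour of plane Lebesgue measure under affine maps
([mu2_affine]), and a line that separates the cell from every hull that does
not contain it ([separation]).

Upper bound: the coefficients used by [value] are nonnegative on the cell, so
the basis functions are nonnegative ([value_ge0]), and they add up to 1
([partition_of_unity], an identity of polynomials on each cell).

Lower bound: let A be the integer matrix of the values of the 39 functions at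
48 points, four in each cell. There is an integer matrix B such that B A is the
identity modulo 31. So det (B A) is nonzero, the coefficients are recovered
linearly from the 48 values, and K is read off the matrix that recovers them
([stability]). The constant depends on the basis only.

The norm ignores null sets, so only points off the finitely many lines through
two of v1, ..., v10 matter. Such a point of T lies in an open cell
([generic_cell]), where the extension by continuity is the polynomial itself
([spline_value]). Conversely the norm bounds these polynomials everywhere on
the open cells, since nonempty open sets are not null ([combination_le_norm]).

Finally an injective family of 39 functions whose range is the basis must be a
permutation of the 39 functions in the table, because each element of the basis
is one of them ([spline_basis_nth]). *)

(** * Lebesgue measure of affine images and lines *)

Section PlaneMeasure.
Context {R : realType}.
Local Notation lambda := (@lebesgue_measure R).
Local Notation mu2 := (lambda \x lambda)%E.
Local Notation line_t := (measurableTypeR R).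
Local Notation plane := (measurableTypeR R * measurableTypeR R)%type.

Lemma measurable_affine (c d : R) :
  measurable_fun [set: line_t] (fun y : line_t => c * y + d : line_t).
Proof. by apply: measurable_funD => //; apply: measurable_funM. Qed.

(** Both sides, as functions of B and multiplied by |c|, are measures; they agree on
intervals. *)
Lemma lebesgue_measure_affine (c d : R) (B : set R) : c != 0 -> measurable B ->
  lambda ((fun y => c * y + d) @^-1` B) = (`|c|^-1%:E * lambda B)%E.
Proof.
move=> c0 mB.
pose phi (y : line_t) : line_t := c * y + d.
have nc : (0 <= `|c|)%R by [].
have [nu nuE] : exists nu : {measure set line_t -> \bar R},
    forall A, nu A = (`|c|%:E * lambda (phi @^-1` A))%E.
  unshelve eexists (mscale (NngNum nc) (pushforward lambda phi)) => //.
  exact: measurable_affine.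
have H : forall A, measurable A -> lambda A = nu A.
  apply: lebesgue_measure_unique => _ [[a b]] _ <-.
  rewrite nuE /=.
  have -> : phi @^-1` `]a, b]%classic =
      if 0 < c then `](a - d) / c, (b - d) / c]%classic
      else `[(b - d) / c, (a - d) / c[%classic.
    apply/seteqP; split => y; rewrite /phi /=; case: ltgtP c0 => // c0 _;
      rewrite /= !in_itv /= => /andP[h1 h2].
    - rewrite ltr_pdivrMr // ler_pdivlMr //; apply/andP; split; lra.
    - rewrite ltr_ndivlMr // ler_ndivrMr //; apply/andP; split; lra.
    - by move: h1 h2; rewrite ltr_pdivrMr // ler_pdivlMr // => h1 h2; apply/andP; split; lra.
    - by move: h1 h2; rewrite ltr_ndivlMr // ler_ndivrMr // => h1 h2; apply/andP; split; lra.
  have itvl (x y : R) (b1 b2 : bool) :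
      lambda [set` Interval (BSide b1 x) (BSide b2 y)] = (Num.max 0 (y - x))%:E.
    rewrite lebesgue_measure_itv /= lte_fin maxEle subr_ge0.
    by case: ltgtP => // ->; rewrite subrr.
  rewrite itvl; case: ltgtP c0 => // c0 _; rewrite itvl -EFinM; congr EFin.
    rewrite gtr0_norm // -mulrBl opprD opprK addrACA addNr addr0.
    rewrite maxr_pMr ?(ltW c0) // mulr0 mulrC divfK //; exact: lt0r_neq0.
  rewrite ltr0_norm // -mulrBl opprD opprK addrACA addNr addr0.
  rewrite maxr_pMr ?oppr_ge0 ?(ltW c0) // mulr0 mulrC mulrN divfK ?opprB //.
  exact: ltr0_neq0.
rewrite [in RHS]H // nuE muleA.
rewrite -EFinM mulVf ?normr_eq0 // mul1e //.
Qed.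

Lemma le_lambda (A B : set R) : A `<=` B -> (lambda A <= lambda B)%E.
Proof. exact: (le_outer_measure (mu_ext (wlength idfun))). Qed.

(** Monotonicity on arbitrary sets: the measure of a set of the plane is the integral
of the outer measures of its sections, and the integral of a nonnegative function
is a supremum over the simple functions below it. It serves to bound the areas of
hulls of many points. *)
Lemma le_mu2 (A B : set plane) : A `<=` B -> (mu2 A <= mu2 B)%E.
Proof.
move=> AB; rewrite /product_measure1 !ge0_integralTE //.
apply: ereal_sup_le => r [h hf hr]; exists h => // x.
apply: le_trans (hf x) _ => /=.
by apply: le_lambda; apply: le_xsection.
Qed.

Definition flip (p : plane) : plane := (p.2, p.1).

Lemma measurable_flip : measurable_fun [set: plane] flip.
Proof. exact: measurable_fun_pair. Qed.

Lemma mu2_flip (A : set plane) : measurable A -> mu2 (flip @^-1` A) = mu2 A.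
Proof.
move=> mA.
have [nu nuE] : exists nu : {measure set plane -> \bar R},
    forall A, nu A = mu2 (flip @^-1` A).
  unshelve eexists (pushforward mu2 flip) => //; exact: measurable_flip.
rewrite -nuE; symmetry.
apply: product_measure_unique => // X Y mX mY.
rewrite nuE (_ : flip @^-1` _ = Y `*` X).
  by rewrite [LHS]product_measure1E // muleC.
by apply/seteqP; split => -[x y] [].
Qed.

(** The vertical sections of the preimage are affine preimages of the sections of A. *)
Lemma mu2_shear (c d e : R) (A : set plane) : d != 0 -> measurable A ->
  mu2 ((fun p => (p.1, c * p.1 + d * p.2 + e)) @^-1` A) = (`|d|^-1%:E * mu2 A)%E.
Proof.
move=> d0 mA; rewrite /product_measure1.
rewrite -ge0_integralZl //; first last.
- exact: measurable_fun_xsection.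
apply: eq_integral => x _ /=.
rewrite -(@lebesgue_measure_affine d (c * x + e)) //; last exact: measurable_xsection.
have E (y : R) : c * x + d * y + e = d * y + (c * x + e).
  by rewrite (addrC (c * x)) -addrA.
by congr (lambda _); apply/seteqP; split => y /=; rewrite /xsection /= !inE /= E.
Qed.

Lemma measurable_affine2 (a b e : R) :
  measurable_fun [set: plane] (fun p => a * p.1 + b * p.2 + e : line_t).
Proof.
by apply: measurable_funD => //; apply: measurable_funD => //; apply: measurable_funM.
Qed.

Lemma measurable_preimage_affine (a b c d e f : R) (A : set plane) : measurable A ->
  measurable ((fun p : plane =>
    (a * p.1 + b * p.2 + e, c * p.1 + d * p.2 + f) : plane) @^-1` A).
Proof.
move=> mA; rewrite -[X in measurable X]setTI.
have : measurable_fun [set: plane] (fun p : plane =>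
    (a * p.1 + b * p.2 + e, c * p.1 + d * p.2 + f) : plane).
  by apply: measurable_fun_pair; exact: measurable_affine2.
exact.
Qed.

(** A shear may also scale and translate here. When d is nonzero, the map is a shear
along the second axis followed by one along the first axis, and the latter is a
shear along the second axis between two flips. When d = 0, the flipped map has b
in the place of d. *)
Lemma mu2_affine (a b c d e f : R) (A : set plane) :
  a * d - b * c != 0 -> measurable A ->
  mu2 ((fun p : plane =>
    (a * p.1 + b * p.2 + e, c * p.1 + d * p.2 + f) : plane) @^-1` A) =
  (`|a * d - b * c|^-1%:E * mu2 A)%E.
Proof.
have mflip (B : set plane) : measurable B -> measurable (flip @^-1` B).
  by move=> mB; rewrite -[X in measurable X]setTI; exact: measurable_flip.
have mshear (c' d' e' : R) (B : set plane) : measurable B ->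
    measurable ((fun p : plane => (p.1, c' * p.1 + d' * p.2 + e') : plane) @^-1` B).
  move=> /(measurable_preimage_affine 1 0 c' d' 0 e').
  congr measurable; apply/seteqP.
  by split => p; rewrite /preimage /= mul1r mul0r !addr0.
have main a0 b0 c0 d0 e0 f0 (B : set plane) : d0 != 0 ->
  a0 * d0 - b0 * c0 != 0 -> measurable B -> mu2 ((fun p : plane =>
    (a0 * p.1 + b0 * p.2 + e0, c0 * p.1 + d0 * p.2 + f0) : plane) @^-1` B) =
  (`|a0 * d0 - b0 * c0|^-1%:E * mu2 B)%E.
  move=> d0N DN mB.
  pose g (p : plane) : plane :=
    (p.1, b0 / d0 * p.1 + (a0 * d0 - b0 * c0) / d0 * p.2 + (e0 - b0 * f0 / d0)).
  have -> : (fun p : plane =>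
    (a0 * p.1 + b0 * p.2 + e0, c0 * p.1 + d0 * p.2 + f0) : plane) @^-1` B =
    (fun p : plane => (p.1, c0 * p.1 + d0 * p.2 + f0) : plane) @^-1`
       (flip @^-1` (g @^-1` (flip @^-1` B))).
    apply: (f_equal (fun h => h @^-1` B)).
    apply/funext => -[x y]; rewrite /flip /g /=; congr pair.
    by field.
  have mg : measurable (g @^-1` (flip @^-1` B)) by apply: mshear; apply: mflip.
  rewrite mu2_shear //; last exact: mflip.
  rewrite mu2_flip //.
  rewrite mu2_shear; [|by rewrite mulf_neq0 ?invr_eq0|exact: mflip].
  rewrite mu2_flip // muleA -EFinM -invfM -normrM; congr ((`|_|^-1)%:E * _)%E.
  by rewrite mulrC divfK.
move=> DN mA; have [d0|dN] := eqVneq d 0; last exact: main.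
have bN : b != 0 by apply: contraNneq DN => ->; rewrite d0 mulr0 mul0r subrr.
rewrite -[in RHS]mu2_flip //.
transitivity (`|c * b - d * a|^-1%:E * mu2 (flip @^-1` A))%E.
  rewrite -(main c d a b f e) //; last exact: mflip.
  by rewrite -oppr_eq0 opprB (mulrC d) (mulrC c).
by rewrite -normrN opprB (mulrC d) (mulrC c).
Qed.

Lemma measurable_line (a b e : R) : measurable [set p : plane | a * p.1 + b * p.2 = e].
Proof.
have := @measurable_affine2 a b (- e) measurableT [set (0 : R)] (measurable_set1 _).
rewrite setTI; congr measurable; apply/seteqP.
by split=> p /=; [move/eqP; rewrite subr_eq0 => /eqP|move=> ->; rewrite subrr].
Qed.

(** When b is nonzero, each vertical section has at most one point; otherwise flip. *)
Lemma mu2_line (a b e : R) : (a != 0) || (b != 0) ->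
  mu2 [set p : plane | a * p.1 + b * p.2 = e] = 0%E.
Proof.
have main a' b' : b' != 0 -> mu2 [set p : plane | a' * p.1 + b' * p.2 = e] = 0%E.
  move=> b0; apply: integral0_eq => x _ /=.
  apply/eqP; rewrite eq_le measure_ge0 andbT.
  apply: le_trans (@le_lambda _ [set (e - a' * x) / b'] _) _; last first.
    by rewrite lebesgue_measure_set1.
  move=> y; rewrite /xsection /= inE /= => <-.
  by rewrite addrAC subrr add0r mulrC mulKf.
have [b0 aN|bN _] := eqVneq b 0; last exact: main.
rewrite orbF in aN; rewrite -mu2_flip; last exact: measurable_line.
rewrite -(main b a aN) b0.
by congr (mu2 _); apply/seteqP; split => p /=; rewrite addrC.
Qed.
End PlaneMeasure.

(** * Area of triangles *)

Section Tri.
Context {R : realType}.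
Local Notation lambda := (@lebesgue_measure R).
Local Notation mu2 := (lambda \x lambda)%E.
Local Notation line_t := (measurableTypeR R).
Local Notation plane := (measurableTypeR R * measurableTypeR R)%type.

Definition unit_triangle : set (R * R) :=
  [set p | [/\ 0 <= p.1, 0 <= p.2 & p.1 + p.2 <= 1]].

Lemma measurable_unit_triangle : measurable (unit_triangle : set plane).
Proof.
have mle a b e : measurable [set p : plane | 0 <= a * p.1 + b * p.2 + e].
  have := @measurable_affine2 R a b e measurableT `[0, +oo[%classic (measurable_itv _).
  rewrite setTI; congr measurable; apply/seteqP.
  by split => p; rewrite /= in_itv /= andbT.
have -> : unit_triangle = [set p : plane | 0 <= 1 * p.1 + 0 * p.2 + 0] `&`
   [set p : plane | 0 <= 0 * p.1 + 1 * p.2 + 0] `&`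
   [set p : plane | 0 <= -1 * p.1 + -1 * p.2 + 1].
  apply/seteqP; split => p /=.
    by case=> h1 h2 h3; split; [split|]; lra.
  by case=> -[h1 h2] h3; split; lra.
by apply: measurableI => //; apply: measurableI.
Qed.

Lemma mu2_square (x y e : R) : (0 <= e) ->
  mu2 (`[x, x + e]%classic `*` `[y, y + e]%classic) = (e ^+ 2)%:E.
Proof.
have itvl (a : R) : 0 <= e -> lambda `[a, a + e]%classic = e%:E.
  rewrite lebesgue_measure_itv /= lte_fin ltrDl.
  by case: ltgtP => // [e0|<-] _ //; rewrite -EFinB addrC addKr.
move=> e0; transitivity (mule (lambda `[x, x + e]%classic) (lambda `[y, y + e]%classic)).
  by apply: product_measure1E; exact: measurable_itv.
by rewrite !itvl.
Qed.

Lemma mu2_unit_triangle_gt0 : (0 < mu2 unit_triangle)%E.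
Proof.
apply: (@lt_le_trans _ _ (2^-1 ^+ 2 : R)%:E); first by rewrite lte_fin exprn_gt0.
rewrite -(mu2_square 0 0) //; apply: le_mu2 => -[x y] /= [].
by rewrite !in_itv /= => /andP[h1 h2] /andP[h3 h4]; split => /=; lra.
Qed.

Lemma mu2_unit_triangle_lty : (mu2 unit_triangle < +oo)%E.
Proof.
apply: (@le_lt_trans _ _ (1 ^+ 2 : R)%:E); last by rewrite ltry.
rewrite -(mu2_square 0 0) //; apply: le_mu2 => -[x y] /= [h1 h2 h3].
by rewrite !in_itv /= in h1 h2 h3 *; split; apply/andP; split; lra.
Qed.

(** Twice the signed area of the triangle pqr. *)
Definition orient (p q r : R * R) : R :=
  (q.1 - p.1) * (r.2 - p.2) - (q.2 - p.2) * (r.1 - p.1).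

Definition closed_triangle (p q r : R * R) : set (R * R) :=
  [set x | [/\ 0 <= orient x q r / orient p q r, 0 <= orient p x r / orient p q r
     & 0 <= orient p q x / orient p q r]].

(** The affine map sends x to its barycentric coordinates at q and r. *)
Lemma closed_triangleE p q r : orient p q r != 0 ->
  closed_triangle p q r = (fun x : plane =>
    ((r.2 - p.2) / orient p q r * x.1 + (- (r.1 - p.1) / orient p q r) * x.2
       + (p.2 * (r.1 - p.1) - p.1 * (r.2 - p.2)) / orient p q r,
     - (q.2 - p.2) / orient p q r * x.1 + (q.1 - p.1) / orient p q r * x.2
       + (p.1 * (q.2 - p.2) - p.2 * (q.1 - p.1)) / orient p q r) : plane) @^-1` unit_triangle.
Proof.
have ge0_eq (a b : R) : a = b -> 0 <= a -> 0 <= b by move=> ->.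
move=> D0; apply/seteqP; split => x; rewrite /closed_triangle /unit_triangle /=;
  case=> h1 h2 h3; move: (D0); rewrite /orient => N.
  split; [apply: ge0_eq h2 | apply: ge0_eq h3 | rewrite -subr_ge0; apply: ge0_eq h1];
    by rewrite /orient; field.
move: h3; rewrite -subr_ge0 => h3.
by split; [apply: ge0_eq h3 | apply: ge0_eq h1 | apply: ge0_eq h2]; rewrite /orient; field.
Qed.

Lemma mu2_closed_triangle p q r : orient p q r != 0 ->
  mu2 (closed_triangle p q r) = (`|orient p q r|%:E * mu2 unit_triangle)%E.
Proof.
move=> D0; rewrite closed_triangleE // mu2_affine; last exact: measurable_unit_triangle.
  congr (_%:E * _)%E; rewrite -normfV; congr `|_|.
  by move: D0; rewrite /orient => D0; field.
suff -> : (r.2 - p.2) / orient p q r * ((q.1 - p.1) / orient p q r) -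
  - (r.1 - p.1) / orient p q r * (- (q.2 - p.2) / orient p q r) =
  (orient p q r)^-1 by rewrite invr_eq0.
by move: D0; rewrite /orient => D0; field.
Qed.

Lemma nbhs_non_negligible (U : set (R * R)) (x : R * R) : nbhs x U ->
  ~ mu2.-negligible (U : set plane).
Proof.
rewrite -nbhs_ballE => -[e /= e0 Ue] [N [mN N0 UN]].
pose Q : set (R * R) := `[x.1, x.1 + e / 2]%classic `*` `[x.2, x.2 + e / 2]%classic.
have : (mu2 Q <= mu2 N)%E.
  apply: le_mu2 => -[y z]; rewrite /Q /= !in_itv /= => -[/andP[h1 h2] /andP[h3 h4]].
  apply/UN/Ue; split; rewrite /ball /= ltr_norml; apply/andP; split; lra.
rewrite mu2_square; last lra.
by rewrite N0 lee_fin leNgt exprn_gt0 //; lra.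
Qed.
End Tri.

(** * Barycentric tables of the twelve cells *)

Definition vec3 (A : Type) : Type := (A * A * A)%type.

Definition dot {A : pzRingType} (u v : vec3 A) : A :=
  u.1.1 * v.1.1 + u.1.2 * v.1.2 + u.2 * v.2.

Definition cross {A : pzRingType} (u v : vec3 A) : vec3 A :=
  (u.1.2 * v.2 - u.2 * v.1.2, u.2 * v.1.1 - u.1.1 * v.2,
   u.1.1 * v.1.2 - u.1.2 * v.1.1).

(** The barycentric coordinates of v1, ..., v6, doubled to make them integral. *)
Definition vertices : seq (vec3 Z) :=
  [:: (2, 0, 0); (0, 2, 0); (0, 0, 2); (1, 1, 0); (0, 1, 1); (1, 0, 1)].

Definition vertex (i : nat) : vec3 Z := nth (0, 0, 0) vertices i.

(** A frame ([:: (i, l_i); (j, l_j); (k, l_k)], d) stands for three affinely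
independent points v_i, v_j, v_k. The integer linear forms l_i, l_j, l_k turn the
barycentric coordinates of a point with respect to v1, v2, v3 into those with
respect to v_i, v_j, v_k, and d = area(T) / area([v_i, v_j, v_k]). *)
Definition frame : Type := (seq (nat * vec3 Z) * Z)%type.

(** Cramer's rule. The factor 2 undoes the doubling of the vertices, and 8 is the
determinant of the doubled corners of T. All divisions are exact. *)
Definition frame_of (i j k : nat) : seq frame :=
  let d := dot (vertex i) (cross (vertex j) (vertex k)) in
  let form p q := let c := cross (vertex p) (vertex q) in
    (Z.div (2 * c.1.1) d, Z.div (2 * c.1.2) d, Z.div (2 * c.2) d) in
  if d == 0 then [::]
  else [:: ([:: (i, form j k); (j, form k i); (k, form i j)], Z.div 8 (Z.abs d))].

Definition frames : seq frame := Eval vm_compute in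
  flatten [seq flatten [seq flatten [seq frame_of i j k
     | k <- iota j.+1 (5 - j)] | j <- iota i.+1 (5 - i)] | i <- iota 0 6].

(** The open cell is where its three [sides] are positive; its [corners] span the
cone over it in barycentric coordinates and form the basis dual to [sides].
The frames in [around] are those whose triangle contains the cell. *)
Definition cell : Type := (seq (vec3 Z) * seq (vec3 Z) * seq frame)%type.
Definition sides (c : cell) : seq (vec3 Z) := c.1.1.
Definition corners (c : cell) : seq (vec3 Z) := c.1.2.
Definition around (c : cell) : seq frame := c.2.

Definition cell_of (ss gs : seq (vec3 Z)) : cell :=
  (ss, gs, [seq f <- frames |
     all (fun e : nat * vec3 Z => all (fun g => 0 <= dot e.2 g) gs) f.1]).

(** The cells where b1 > b2 > b3 are [v1, v4, v7] and [v4, v7, v10]; the permutations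
of the coordinates give the other ten. *)
Definition cells : seq cell := Eval vm_compute in
  flatten [seq
    [:: cell_of (map pi [:: (1, -1, -1); (0, 1, -1); (0, 0, 1)])
                (map pi [:: (1, 0, 0); (1, 1, 0); (2, 1, 1)]);
        cell_of (map pi [:: (0, 1, -1); (1, -1, 0); (-1, 1, 1)])
                (map pi [:: (1, 1, 0); (2, 1, 1); (1, 1, 1)])]
  | pi : vec3 Z -> vec3 Z <-
      [:: (fun u => (u.1.1, u.1.2, u.2)); (fun u => (u.1.1, u.2, u.1.2));
          (fun u => (u.1.2, u.1.1, u.2)); (fun u => (u.1.2, u.2, u.1.1));
          (fun u => (u.2, u.1.1, u.1.2)); (fun u => (u.2, u.1.2, u.1.1))]].

(** A multiset of knots is the list m of the multiplicities of v1, ..., v6. *)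
Definition covers (m : seq nat) (f : frame) : bool :=
  all (fun e : nat * vec3 Z => (0 < nth 0%N m e.1)%N) f.1.

Definition dec (m : seq nat) (i : nat) : seq nat :=
  set_nth 0%N m i (nth 0%N m i).-1.

Fixpoint first_frame (m : seq nat) (fs : seq frame) : option frame :=
  if fs is f :: fs' then if covers m f then Some f else first_frame m fs'
  else None.

(** The carrier of the recursion is left open: it will be the real numbers, the
integers (values at sample points) and lists of coefficients (polynomials). In
[scale l a], the form l is evaluated at the point in question. *)
Section Piece.
Context {A : Type}.
Variables (zero : A) (add : A -> A -> A) (scale : vec3 Z -> A -> A) (cst : Z -> A).

Fixpoint piece (fs : seq frame) (n : nat) (m : seq nat) : A :=
  if first_frame m fs is Some f then
    if n is n'.+1 then
      foldr (fun e : nat * vec3 Z =>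
         add (scale e.2 (piece fs n' (dec m e.1)))) zero f.1
    else cst f.2
  else zero.
End Piece.

Section PieceMorph.
Context {A B : Type} (h : A -> B).
Variables (zero : A) (add : A -> A -> A) (scale : vec3 Z -> A -> A) (cst : Z -> A).
Variables (zero' : B) (add' : B -> B -> B) (scale' : vec3 Z -> B -> B) (cst' : Z -> B).
Hypotheses (h0 : h zero = zero') (hD : forall x y, h (add x y) = add' (h x) (h y))
  (hZ : forall l x, h (scale l x) = scale' l (h x)) (hc : forall c, h (cst c) = cst' c).

Lemma piece_morph fs n m :
  h (piece zero add scale cst fs n m) = piece zero' add' scale' cst' fs n m.
Proof.
elim: n m => [|n IH] m /=; case: first_frame => // f.
by elim: f.1 => //= e s IHs; rewrite hD hZ IH IHs.
Qed.
End PieceMorph.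

(** The integers of the tables are binary, so that the tables can be evaluated; this
is their embedding into a ring. *)
Definition zr (R : pzRingType) (z : Z) : R := (int_of_Z z)%:~R.
Arguments zr R z%_ring_scope.
HB.instance Definition _ (R : pzRingType) :=
  GRing.RMorphism.copy (@zr R) (intr \o int_of_Z).

Lemma zrD (R : pzRingType) x y : zr R (Z.add x y) = zr R x + zr R y.
Proof. exact: rmorphD. Qed.

Lemma zrB (R : pzRingType) x y : zr R (Z.sub x y) = zr R x - zr R y.
Proof. exact: rmorphB. Qed.

Lemma zrM (R : pzRingType) x y : zr R (Z.mul x y) = zr R x * zr R y.
Proof. exact: rmorphM. Qed.

Lemma zr0 (R : pzRingType) : zr R Z0 = 0. Proof. exact: rmorph0. Qed.

Lemma zr1 (R : pzRingType) : zr R (Zpos 1) = 1. Proof. exact: rmorph1. Qed.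

Lemma zr_nat (R : pzRingType) n : zr R (Z.of_nat n) = n%:R.
Proof. by rewrite /zr -[Z.of_nat n]/(Z_of_int (Posz n)) Z_of_intK. Qed.

Definition zr3 (R : pzRingType) (l : vec3 Z) : vec3 R := (zr R l.1.1, zr R l.1.2, zr R l.2).

Lemma dot_zr3 (R : comPzRingType) (u v : vec3 Z) : dot (zr3 R u) (zr3 R v) = zr R (dot u v).
Proof. by rewrite /dot /= !rmorphD !rmorphM. Qed.

Definition unit3 : seq (vec3 Z) := [:: (1, 0, 0); (0, 1, 0); (0, 0, 1)].

(** The pairing sum_e e.1(x) e.2(y) is k times the scalar product of x and y; by
bilinearity it is enough to test it on unit vectors. *)
Definition dual_pairs (k : Z) (s : seq (vec3 Z * vec3 Z)) : bool :=
  all (fun a => all (fun d =>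
     foldr (fun (e : vec3 Z * vec3 Z) x => Z.add (Z.mul (dot e.1 a) (dot e.2 d)) x) Z0 s
       == k * dot a d) unit3) unit3.

Arguments dual_pairs k%_ring_scope s.

Definition dual_frame (f : frame) : bool :=
  all (fun e : nat * vec3 Z => (e.1 < 6)%N) f.1 &&
  dual_pairs 2 [seq (e.2, vertex e.1) | e : nat * vec3 Z <- f.1].

Lemma frames_dual : all dual_frame frames. Proof. by vm_compute. Qed.

Lemma around_frames c : c \in map around cells -> {subset c <= frames}.
Proof.
have : all (fun c => all (mem frames) c) (map around cells) by vm_compute.
by move=> /allP h /h /allP.
Qed.

Fixpoint compositions (d n : nat) : seq (seq nat) :=
  if d is d'.+1 then
    flatten [seq [seq k :: s | s <- compositions d' (n - k)] | k <- iota 0 n.+1]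
  else if n is 0 then [:: [::]] else [::].

Lemma mem_compositions d n s : size s = d -> sumn s = n -> s \in compositions d n.
Proof.
elim: d n s => [|d IH] n [|k s]; [by move=> _ <- | by [] | by [] |].
move=> [ss] <-; apply/flattenP.
exists [seq k :: s' | s' <- compositions d (sumn (k :: s) - k)].
  by apply/mapP; exists k => //; rewrite mem_iota /= ltnS leq_addr.
by apply: map_f; apply: IH; rewrite //= addKn.
Qed.

Definition zpiece (b : vec3 Z) := piece Z0 Z.add (fun l => Z.mul
  (Z.add (Z.add (Z.mul l.1.1 b.1.1) (Z.mul l.1.2 b.1.2)) (Z.mul l.2 b.2))) id.

(** The only candidate for u when K has four knots: the form with the required
values at the three points of the frame. *)
Definition gradient4 (fs : seq frame) (m : seq nat) : vec3 Z :=
  if first_frame m fs is Some f then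
    foldr (fun (e : nat * vec3 Z) u => let q := zpiece (0, 0, 0) fs 0 (dec m e.1) in
       (Z.add (Z.mul q e.2.1.1) u.1.1, Z.add (Z.mul q e.2.1.2) u.1.2, Z.add (Z.mul q e.2.2) u.2))
       (Z0, Z0, Z0) f.1
  else (Z0, Z0, Z0).

Definition gradient4_ok (fs : seq frame) (m : seq nat) : bool :=
  all (fun j => (0 < nth 0%N m j)%N ==>
    (dot (gradient4 fs m) (vertex j) == 2 * zpiece (0, 0, 0) fs 0 (dec m j))) (iota 0 6).

(** Four knots: the functions Q[K \ v_j] are constants on the cell, and the form that
fits three of them fits the fourth. *)
Lemma gradient4_table :
  all (fun fs => all (gradient4_ok fs) (compositions 6 4)) (map around cells).
Proof. by vm_compute. Qed.

(** * Independence of the choice of barycentric coordinates *)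

Lemma nth_dec m i j : nth 0%N (dec m i) j = (nth 0%N m j - (j == i))%N.
Proof.
by rewrite /dec nth_set_nth /=; case: eqVneq => [->|_]; rewrite ?subn1 ?subn0.
Qed.

Lemma size_dec m i : (i < size m)%N -> size (dec m i) = size m.
Proof. by move=> im; rewrite size_set_nth; apply/maxn_idPr. Qed.

Lemma sumn_dec m i : (0 < nth 0%N m i)%N -> sumn (dec m i) = (sumn m).-1.
Proof. by move=> m0; rewrite sumn_set_nth0; lia. Qed.

Lemma decC m i j : (i < size m)%N -> (j < size m)%N ->
  dec (dec m i) j = dec (dec m j) i.
Proof.
move=> im jm; apply: (@eq_from_nth _ 0%N) => [|k _].
  by rewrite !size_dec ?size_dec.
by rewrite !nth_dec -!subnDA addnC.
Qed.

Lemma first_frameP m fs :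
  if first_frame m fs is Some f then f \in fs /\ covers m f
  else forall f, f \in fs -> ~~ covers m f.
Proof.
elim: fs => [|f fs IH] //=; case: ifPn => [cf|ncf]; first by rewrite mem_head.
case: first_frame IH => [g [gfs cg]|IH]; first by rewrite inE gfs orbT.
by move=> g; rewrite inE => /predU1P[->|/IH].
Qed.

Lemma covers_dec m i f : covers (dec m i) f -> covers m f.
Proof.
by move=> /allP h; apply/allP => e /h; rewrite nth_dec => /leq_trans; apply; apply: leq_subr.
Qed.

Lemma first_frame_dec m i fs : first_frame m fs = None -> first_frame (dec m i) fs = None.
Proof.
move=> mN; have := first_frameP m fs; rewrite mN => h.
have := first_frameP (dec m i) fs; case: first_frame => // f [/h + /covers_dec cf].
by rewrite cf.
Qed.

Section Value.
Context {R : realType}.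
Implicit Types (b u : vec3 R) (m : seq nat).

Definition vertexR (i : nat) : vec3 R := 2^-1 *: (zr3 R (vertex i) : R * R * R).

Definition value b := piece (0 : R) +%R (fun l x => dot (zr3 R l) b * x) (@zr R).

Lemma valueE b fs n m : value b fs n m =
  if first_frame m fs is Some f then
    if n is n'.+1 then
      \sum_(e <- f.1) dot (zr3 R e.2) b * value b fs n' (dec m e.1)
    else zr R f.2
  else 0.
Proof.
rewrite /value; case: n => [|n] //=; case: first_frame => // f.
by rewrite unlock; elim: f.1 => //= e s ->.
Qed.

Lemma value_None b fs n m : first_frame m fs = None -> value b fs n m = 0.
Proof. by rewrite valueE => ->. Qed.

Lemma dotDl u u' b : dot (u + u') b = dot u b + dot u' b.
Proof.
change (dot (u + u') b) with ((u.1.1 + u'.1.1) * b.1.1 +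
  (u.1.2 + u'.1.2) * b.1.2 + (u.2 + u'.2) * b.2).
by rewrite /dot; ring.
Qed.

Lemma dotZl (k : R) u b : dot (k *: (u : R * R * R)) b = k * dot u b.
Proof.
change (dot (k *: (u : R * R * R)) b) with
  (k * u.1.1 * b.1.1 + k * u.1.2 * b.1.2 + k * u.2 * b.2).
by rewrite /dot; ring.
Qed.

Lemma dotC u b : dot u b = dot b u.
Proof. by rewrite /dot; ring. Qed.

Lemma dot_suml I (s : seq I) (k : I -> R) (U : I -> vec3 R) b :
  dot (\sum_(i <- s) k i *: (U i : R * R * R)) b = \sum_(i <- s) k i * dot (U i) b.
Proof.
elim: s => [|i s IH]; last by rewrite !big_cons dotDl dotZl IH.
by rewrite !big_nil /dot /= !mul0r !addr0.
Qed.

Lemma dual_pairsE k s b u : dual_pairs k s ->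
  \sum_(e <- s) dot (zr3 R e.1) b * dot (zr3 R e.2) u = zr R k * dot b u.
Proof.
move=> /allP h.
have {}h a d : a \in unit3 -> d \in unit3 ->
    \sum_(e <- s) zr R (dot e.1 a) * zr R (dot e.2 d) = zr R (k * dot a d).
  move=> ha hd; have /allP h' := h a ha; have /eqP E := h' d hd.
  apply: etrans (f_equal (zr R) E).
  elim: s {h h' E} => [|e s IH]; first by rewrite big_nil /= zr0.
  by rewrite big_cons IH /= zrD zrM.
transitivity (
  b.1.1 * u.1.1 * (\sum_(e <- s) zr R (dot e.1 (1, 0, 0)) * zr R (dot e.2 (1, 0, 0))) +
  b.1.1 * u.1.2 * (\sum_(e <- s) zr R (dot e.1 (1, 0, 0)) * zr R (dot e.2 (0, 1, 0))) +
  b.1.1 * u.2 * (\sum_(e <- s) zr R (dot e.1 (1, 0, 0)) * zr R (dot e.2 (0, 0, 1))) +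
  b.1.2 * u.1.1 * (\sum_(e <- s) zr R (dot e.1 (0, 1, 0)) * zr R (dot e.2 (1, 0, 0))) +
  b.1.2 * u.1.2 * (\sum_(e <- s) zr R (dot e.1 (0, 1, 0)) * zr R (dot e.2 (0, 1, 0))) +
  b.1.2 * u.2 * (\sum_(e <- s) zr R (dot e.1 (0, 1, 0)) * zr R (dot e.2 (0, 0, 1))) +
  b.2 * u.1.1 * (\sum_(e <- s) zr R (dot e.1 (0, 0, 1)) * zr R (dot e.2 (1, 0, 0))) +
  b.2 * u.1.2 * (\sum_(e <- s) zr R (dot e.1 (0, 0, 1)) * zr R (dot e.2 (0, 1, 0))) +
  b.2 * u.2 * (\sum_(e <- s) zr R (dot e.1 (0, 0, 1)) * zr R (dot e.2 (0, 0, 1)))).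
  rewrite !mulr_sumr -!big_split /=; apply: eq_bigr => e _.
  by rewrite /dot /= !(mulr0, mulr1, addr0, add0r); ring.
by rewrite !h // /dot /= !(mulr0, mulr1, addr0, add0r); ring.
Qed.

Lemma dot_vertexR u i : dot u (vertexR i) = 2^-1 * dot u (zr3 R (vertex i)).
Proof. by rewrite dotC dotZl dotC. Qed.

Lemma frame_combination f u b : dual_frame f ->
  dot u b = \sum_(e <- f.1) dot (zr3 R e.2) b * dot u (vertexR e.1).
Proof.
move=> /andP[_ /(dual_pairsE b u)]; rewrite big_map rmorph_nat => E.
apply: (@mulfI _ 2); first by rewrite pnatr_eq0.
rewrite [in LHS]dotC -E mulr_sumr; apply: eq_bigr => e _.
by rewrite dot_vertexR [dot _ u]dotC; field.
Qed.

Lemma dot_inj b b' : (forall u, dot u b = dot u b') -> b = b'.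
Proof.
move=> h; case: b b' h => -[b1 b2] b3 [[c1 c2] c3] h.
have := (h (1, 0, 0), h (0, 1, 0), h (0, 0, 1)).
by rewrite /dot /= !mul1r !mul0r !addr0 !add0r => -[[-> ->] ->].
Qed.

Lemma frame_coordinates f b : dual_frame f ->
  b = \sum_(e <- f.1) dot (zr3 R e.2) b *: (vertexR e.1 : R * R * R).
Proof.
move=> df; apply: dot_inj => u; rewrite (frame_combination u b df) [RHS]dotC dot_suml.
by apply: eq_bigr => e _; rewrite [dot _ u]dotC.
Qed.

Lemma zpieceE (z : vec3 Z) fs n m : zr R (zpiece z fs n m) = value (zr3 R z) fs n m.
Proof.
apply: piece_morph => //= [x y|l x]; first exact: rmorphD.
by rewrite dot_zr3; exact: rmorphM.
Qed.

Lemma value0 (b b' : vec3 R) fs m : value b fs 0 m = value b' fs 0 m.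
Proof. by rewrite !valueE. Qed.

Lemma gradient4E (fs : seq frame) (m : seq nat) b :
  dot (zr3 R (gradient4 fs m)) b = value b fs 1 m.
Proof.
rewrite valueE /gradient4; case: first_frame => [f|]; last by rewrite /dot /zr3 /= !mul0r !addr0.
elim: f.1 => [|e s IH]; first by rewrite big_nil /dot /zr3 /= !mul0r !addr0.
rewrite big_cons -IH (value0 b (zr3 R (0, 0, 0))) -zpieceE /=.
by rewrite /dot /= /zr3 /= !zrD !zrM; ring.
Qed.

(** Derivatives of simplex splines, without differentiating. The witness u is the
combination of the forms of the K \ v_e, weighted by the barycentric coordinates
of b; that it fits at v_j is the symmetry of removing two knots in either order. *)
Lemma gradient_exists fs b n m : fs \in map around cells ->
    size m = 6%N -> sumn m = (n + 4)%N ->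
  exists u, (forall j, (j < 6)%N -> (0 < nth 0%N m j)%N ->
      value b fs n (dec m j) = dot u (vertexR j)) /\
    value b fs n.+1 m = dot u b.
Proof.
move=> fsc.
have fs_dual f : f \in fs -> dual_frame f.
  by move=> ffs; apply: (allP frames_dual); apply: (around_frames fsc).
elim: n m => [|n IH] m sm wm.
  exists (zr3 R (gradient4 fs m)); split; last by rewrite gradient4E.
  move=> j j6 mj; rewrite (value0 b (zr3 R (0, 0, 0))) -zpieceE dot_vertexR dot_zr3.
  have /allP/(_ fs fsc)/allP/(_ m) := gradient4_table.
  rewrite mem_compositions // => /(_ isT)/allP/(_ j).
  rewrite mem_iota j6 mj => /(_ isT)/= /eqP ->.
  by rewrite rmorphM rmorph_nat mulKf // pnatr_eq0.
case E: (first_frame m fs) => [f|]; last first.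
  exists 0; split => [j j6 mj|]; last by rewrite value_None // /dot !mul0r !addr0.
  by rewrite value_None ?first_frame_dec // /dot !mul0r !addr0.
have := first_frameP m fs; rewrite E => -[ffs fm].
have {}IH j : exists u, (j < 6)%N -> (0 < nth 0%N m j)%N ->
   (forall i, (i < 6)%N -> (0 < nth 0%N (dec m j) i)%N ->
      value b fs n (dec (dec m j) i) = dot u (vertexR i)) /\
    value b fs n.+1 (dec m j) = dot u b.
  have [j6|] := ltnP j 6; last by exists 0.
  have [mj|] := ltnP 0 (nth 0%N m j); last by exists 0.
  have [||u hu] := IH (dec m j); [by rewrite size_dec sm | by rewrite sumn_dec // wm | by exists u].
have {IH} [U hU] := choice IH.
have f6 e : e \in f.1 -> (e.1 < 6)%N /\ (0 < nth 0%N m e.1)%N.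
  move=> ef; split; last exact: (allP fm).
  by have /andP[/allP h _] := fs_dual f ffs; exact: h.
exists (\sum_(e <- f.1) dot (zr3 R e.2) b *: (U e.1 : R * R * R)); split.
  move=> j j6 mj; rewrite (hU j j6 mj).2 (frame_combination _ _ (fs_dual f ffs)) dot_suml.
  apply: eq_big_seq => e ef; congr (_ * _); have [e6 me] := f6 e ef.
  (* u_e(v_j) = u_j(v_e): both are the value with v_e and v_j removed. *)
  have [<- //|ej] := eqVneq e.1 j.
  rewrite -(hU j j6 mj).1 //; last by rewrite nth_dec (negbTE ej) subn0.
  rewrite -(hU _ e6 me).1 //; last by rewrite nth_dec eq_sym (negbTE ej) subn0.
  by rewrite decC ?sm.
rewrite valueE E dot_suml; apply: eq_big_seq => e ef; congr (_ * _).
by have [e6 me] := f6 e ef; exact: (hU _ e6 me).2.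
Qed.

End Value.

(** * Signs on a cell *)

Lemma mem_zip (S T : eqType) (s : seq S) (t : seq T) e :
  e \in zip s t -> e.1 \in s /\ e.2 \in t.
Proof.
elim: s t => [|x s IH] [|y t] //=.
by rewrite !inE => /predU1P[->|/IH[-> ->]]; rewrite ?eqxx ?orbT.
Qed.

Definition dual_cell (c : cell) : bool := dual_pairs 1 (zip (sides c) (corners c)).

Lemma cells_dual : all dual_cell cells. Proof. by vm_compute. Qed.

Lemma cells_around : all (fun c => all (fun f : frame =>
  all (fun e : nat * vec3 Z => all (fun g => 0 <= dot e.2 g) (corners c)) f.1) (around c)) cells.
Proof. by vm_compute. Qed.

Lemma cells_weight : all (fun c => all (fun f : frame => 0 <= f.2) (around c)) cells.
Proof. by vm_compute. Qed.

(** The nine lines of the split, as linear forms in barycentric coordinates. *)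
Definition lines : seq (vec3 Z) :=
  [:: (1, 0, 0); (0, 1, 0); (0, 0, 1); (1, -1, 0); (0, 1, -1); (1, 0, -1);
      (1, -1, -1); (-1, 1, -1); (-1, -1, 1)].

Fixpoint bits (d : nat) : seq (seq nat) :=
  if d is d'.+1 then [seq 0%N :: s | s <- bits d'] ++ [seq 1%N :: s | s <- bits d']
  else [:: [::]].

(** Hulls and frames depend only on which knots occur, so 64 cases suffice. *)
Definition support (m : seq nat) : seq nat := [seq (0 < k)%N : nat | k <- m].

Lemma support_bits m : support m \in bits (size m).
Proof.
elim: m => [|k m IH] //=; rewrite mem_cat.
by case: (0 < k)%N; rewrite (map_f (cons _)) ?orbT.
Qed.

Lemma nth_support m i : (0 < nth 0 (support m) i)%N = (0 < nth 0 m i)%N.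
Proof.
by elim: m i => [|k m IH] [|i] //=; case: (0 < k)%N.
Qed.

Lemma first_frame_support m fs : first_frame (support m) fs = first_frame m fs.
Proof.
elim: fs => //= f fs ->; congr (if _ then _ else _).
by apply: eq_all => e; rewrite nth_support.
Qed.

Definition separates (c : cell) (m : seq nat) (l : vec3 Z) : bool :=
  [&& all (fun j => (0 < nth 0%N m j)%N ==> (dot l (vertex j) <= 0)) (iota 0 6),
      all (fun g => 0 <= dot l g) (corners c) &
      has (fun e : vec3 Z * vec3 Z => 0 < dot l e.2) (zip (sides c) (corners c))].

Definition signed_lines := lines ++ [seq (- l.1.1, - l.1.2, - l.2) : vec3 Z | l : vec3 Z <- lines].

Lemma separation_table : all (fun c => all (fun m =>
  (first_frame m (around c) == None) ==> has (separates c m) signed_lines)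
  (bits 6)) cells.
Proof. by vm_compute. Qed.

Section Value.
Context {R : realType}.
Implicit Types (b u : vec3 R) (m : seq nat).

(** Any barycentric coordinates may replace those of the frame: both sides equal
u(b) for the form u of [gradient_exists]. *)
Lemma value_step b fs n m (beta : nat -> R) :
    fs \in map around cells -> size m = 6%N -> sumn m = (n + 4)%N ->
    (forall j, (j < 6)%N -> nth 0%N m j = 0%N -> beta j = 0) ->
    b = \sum_(j <- iota 0 6) beta j *: (vertexR j : R * R * R) ->
  \sum_(j <- iota 0 6) beta j * value b fs n (dec m j) = value b fs n.+1 m.
Proof.
move=> fsc sm wm beta0 bE.
have [u [hu ->]] := gradient_exists b fsc sm wm.
rewrite dotC {2}bE dot_suml; apply: eq_big_seq => j; rewrite mem_iota => /= j6.
have [/beta0->//|] := posnP (nth 0%N m j); first by rewrite !mul0r.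
by move=> /(hu _ j6) ->; rewrite dotC.
Qed.

Definition open_cell (c : cell) (b : vec3 R) : Prop :=
  forall l, l \in sides c -> 0 < dot (zr3 R l) b.

Lemma zr_ge0 (z : Z) : 0 <= z -> 0 <= zr R z.
Proof. by case: z => // p _; rewrite /zr ler0z. Qed.

Lemma zr_gt0 (z : Z) : 0 < z -> 0 < zr R z.
Proof. by case: z => // p _; rewrite /zr ltr0z /= ltz_nat; lia. Qed.

Lemma cell_coordinates c b u : c \in cells ->
  dot u b = \sum_(e <- zip (sides c) (corners c)) dot (zr3 R e.1) b * dot u (zr3 R e.2).
Proof.
move=> /(allP cells_dual)/(dual_pairsE b u); rewrite rmorph1 mul1r dotC => <-.
by apply: eq_bigr => e _; rewrite [dot _ u]dotC.
Qed.

Lemma cell_ge0 c b l : c \in cells -> open_cell c b ->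
  all (fun g => 0 <= dot l g) (corners c) -> 0 <= dot (zr3 R l) b.
Proof.
move=> cc bc /allP lg; rewrite (cell_coordinates b _ cc).
rewrite big_seq; apply: sumr_ge0 => -[p g] /mem_zip[/= /bc sp /lg lg0].
by rewrite dot_zr3; apply: mulr_ge0; [exact: ltW|exact: zr_ge0].
Qed.

Lemma value_ge0 c b n m : c \in cells -> open_cell c b -> 0 <= value b (around c) n m.
Proof.
move=> cc bc; elim: n m => [|n IH] m; rewrite valueE; have := first_frameP m (around c);
  case: first_frame => // f [fc _].
  by apply: zr_ge0; exact: (allP (allP cells_weight _ cc)).
rewrite big_seq; apply: sumr_ge0 => e ef; apply: mulr_ge0 => //.
apply: (cell_ge0 cc bc).
by have /allP/(_ _ fc)/allP/(_ _ ef) := allP cells_around _ cc.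
Qed.

Lemma valueZ k b fs n m : value (k *: (b : R * R * R)) fs n m = k ^+ n * value b fs n m.
Proof.
elim: n m => [|n IH] m; rewrite !valueE; case: first_frame => [f|]; rewrite ?mulr0 ?mul1r //.
rewrite mulr_sumr; apply: eq_bigr => e _; rewrite IH dotC dotZl dotC exprS.
by ring.
Qed.

(** A hull of knots is a polygon, segment or point bounded by the nine lines. If no
frame with these knots contains the cell, one of the lines has the cell strictly
on one side and the knots weakly on the other. *)
Lemma separation c m b : c \in cells -> size m = 6%N -> open_cell c b ->
  first_frame m (around c) = None ->
  exists l : vec3 R, (forall j, (j < 6)%N -> (0 < nth 0%N m j)%N -> dot l (vertexR j) <= 0)
     /\ 0 < dot l b.
Proof.
move=> cc sm bc mN; have /allP h := separation_table; have /allP h' := h _ cc.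
have sb : support m \in bits 6 by rewrite -sm support_bits.
have := h' _ sb; rewrite first_frame_support mN eqxx => /hasP[l _].
move=> /and3P[/allP lv /allP lg /hasP[e ez le]].
have e_ge0 i : i \in zip (sides c) (corners c) ->
    0 <= dot (zr3 R i.1) b * dot (zr3 R l) (zr3 R i.2).
  case: i => p g /mem_zip[/= /bc sp /lg lg0].
  by rewrite dot_zr3; apply: mulr_ge0; [exact: ltW|exact: zr_ge0].
exists (zr3 R l); split => [j j6 mj|].
  have := lv j; rewrite mem_iota j6 nth_support mj => /(_ isT)/= lj.
  rewrite dot_vertexR dot_zr3 pmulr_rle0 ?invr_gt0 //.
  by rewrite -oppr_ge0 -rmorphN; apply: zr_ge0; rewrite oppr_ge0.
rewrite (cell_coordinates b _ cc) lt_neqAle big_seq sumr_ge0 // andbT eq_sym.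
rewrite psumr_eq0 //; apply/allPn; exists e => //; rewrite ez /=.
have [s1 _] := mem_zip ez.
by apply: lt0r_neq0; rewrite dot_zr3; apply: mulr_gt0; [exact: bc|exact: zr_gt0].
Qed.
End Value.

(** * Partition of unity and sampling *)

(** Weights are multiplied by 4 to make them integral. *)
Definition generators (star : basis_name) : seq (nat * seq nat) :=
  [:: (1, [:: 6; 0; 0; 1; 0; 1]); (1, [:: 5; 0; 0; 2; 0; 1]);
      (2, [:: 4; 1; 0; 2; 0; 1]);
      match star with
      | Ba | Bb | Bc => (2, [:: 3; 2; 0; 2; 0; 1])
      | Bd | Be | Bf => (4, [:: 3; 2; 1; 2; 0; 0])
      end;
      (4, [:: 1; 4; 1; 1; 1; 0]); (2, [:: 1; 3; 1; 2; 1; 0])]%N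
  ++ match star with
     | Ba => [:: (3, [:: 2; 2; 2; 1; 1; 0]); (3, [:: 2; 2; 1; 2; 1; 0])]%N
     | Bb => [:: (3, [:: 2; 2; 1; 1; 1; 1]); (3, [:: 2; 2; 1; 2; 1; 0])]%N
     | Bc => [:: (3, [:: 2; 2; 0; 2; 1; 1]); (3, [:: 1; 2; 1; 2; 1; 1])]%N
     | Bd => [:: (3, [:: 2; 2; 2; 1; 1; 0]); (1, [:: 2; 2; 1; 2; 1; 0])]%N
     | Be => [:: (3, [:: 2; 2; 1; 1; 1; 1]); (1, [:: 2; 2; 1; 2; 1; 0])]%N
     | Bf => [:: (1, [:: 2; 2; 0; 2; 1; 1]); (2, [:: 1; 2; 1; 2; 1; 1])]%N
     end.

(** The six permutations of v1, ..., v6, each given by the list of the indices of the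
images. *)
Definition symmetries : seq (seq nat) :=
  [:: [:: 0; 1; 2; 3; 4; 5]; [:: 0; 2; 1; 5; 4; 3]; [:: 1; 0; 2; 3; 5; 4];
      [:: 1; 2; 0; 4; 5; 3]; [:: 2; 0; 1; 5; 3; 4]; [:: 2; 1; 0; 4; 3; 5]]%N.

Definition permute (t m : seq nat) : seq nat :=
  mkseq (fun i => nth 0%N m (index i t)) 6.

(** The orbits of the generators, without the repetitions due to stabilizers. *)
Definition splines (star : basis_name) : seq (nat * seq nat) :=
  undup (flatten [seq [seq (g.1, permute t g.2) | t <- symmetries]
                 | g : nat * seq nat <- generators star]).

Lemma size_splines star : size (splines star) = 39%N.
Proof. by case: star; vm_compute. Qed.

Lemma splines_knots star : all (fun e : nat * seq nat =>
  (size e.2 == 6%N) && (sumn e.2 == 8%N)) (splines star).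
Proof. by case: star; vm_compute. Qed.

Fixpoint zip_add (T : Type) (op : T -> T -> T) (s t : seq T) : seq T :=
  match s, t with
  | x :: s', y :: t' => op x y :: zip_add op s' t'
  | [::], _ => t
  | _, [::] => s
  end.

(** Polynomials in y = b2 and z = b3 after the substitution b1 = 1 - y - z: a list over
the powers of y of lists over the powers of z. *)
Definition poly2 : Type := seq (seq Z).
Definition padd : poly2 -> poly2 -> poly2 := zip_add (zip_add Z.add).
Definition pscale (k : Z) : poly2 -> poly2 := map (map (Z.mul k)).
Definition plinear (l : vec3 Z) (p : poly2) : poly2 :=
  padd (pscale l.1.1 p)
    (padd ([::] :: pscale (Z.sub l.1.2 l.1.1) p)
          (map (cons Z0) (pscale (Z.sub l.2 l.1.1) p))).
Definition ppiece := piece [::] padd plinear (fun k => [:: [:: k]]).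

Definition pnull (p : poly2) : bool := all (all (Z.eqb Z0)) p.

Definition weighted_sum (star : basis_name) (c : cell) : poly2 :=
  foldr (fun (e : nat * seq nat) p =>
     padd (pscale (Z.of_nat e.1) (ppiece (around c) 5 e.2)) p) [::] (splines star).

(** The partition of unity, coefficient by coefficient. *)
Lemma weighted_sum_table star :
  all (fun c => pnull (padd (weighted_sum star c) [:: [:: - 4%:R]])) cells.
Proof. by case: star; vm_compute. Qed.

Section Eval.
Context {R : realType}.
Variables (y z : R).

Definition eval1 (p : seq Z) : R := foldr (fun k x => zr R k + z * x) 0 p.
Definition eval2 (p : poly2) : R := foldr (fun k x => eval1 k + y * x) 0 p.

Lemma eval1D p q : eval1 (zip_add Z.add p q) = eval1 p + eval1 q.
Proof.
elim: p q => [|a p IH] [|b q] /=; rewrite ?add0r ?addr0 // IH zrD; ring.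
Qed.

Lemma eval2D p q : eval2 (padd p q) = eval2 p + eval2 q.
Proof.
by elim: p q => [|a p IH] [|b q] /=; rewrite ?add0r ?addr0 // IH eval1D; ring.
Qed.

Lemma eval1Z k p : eval1 (map (Z.mul k) p) = zr R k * eval1 p.
Proof. by elim: p => [|a p IH] /=; rewrite ?mulr0 // IH zrM; ring. Qed.

Lemma eval2Z k p : eval2 (pscale k p) = zr R k * eval2 p.
Proof. by elim: p => [|a p IH] /=; rewrite ?mulr0 // IH eval1Z; ring. Qed.

Lemma eval2_shift p : eval2 (map (cons Z0) p) = z * eval2 p.
Proof.
by elim: p => [|a p IH] /=; rewrite ?mulr0 // IH zr0; ring.
Qed.

Lemma eval2_linear l p :
  eval2 (plinear l p) = dot (zr3 R l) (1 - y - z, y, z) * eval2 p.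
Proof.
rewrite /plinear !eval2D eval2Z eval2_shift eval2Z /= eval2Z !zrB /dot /=; ring.
Qed.

Lemma eval2_piece fs n m : eval2 (ppiece fs n m) = value (1 - y - z, y, z) fs n m.
Proof.
apply: piece_morph => [//|p q|l p|k].
- exact: eval2D.
- exact: eval2_linear.
- by rewrite /= !mulr0 !addr0.
Qed.

Lemma eval2_sum (I : Type) (s : seq I) (F : I -> poly2) :
  eval2 (foldr (fun i => padd (F i)) [::] s) = \sum_(i <- s) eval2 (F i).
Proof.
by elim: s => [|i s IH]; rewrite ?big_nil // big_cons /= eval2D IH.
Qed.

Lemma eval2_null p : pnull p -> eval2 p = 0.
Proof.
have e1 q : all (Z.eqb Z0) q -> eval1 q = 0.
  by elim: q => //= -[|a|a] q IH //= h; rewrite IH // mulr0 addr0 zr0.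
by elim: p => //= a p IH /andP[/e1 -> /IH ->]; rewrite mulr0 addr0.
Qed.
End Eval.

Lemma partition_of_unity (R : realType) star c (b : vec3 R) : c \in cells ->
  b.1.1 + b.1.2 + b.2 = 1 ->
  \sum_(e <- splines star) e.1%:R * value b (around c) 5 e.2 = 4.
Proof.
case: b => -[x y] z cc /= s1; have {x s1} -> : x = 1 - y - z by rewrite -s1; ring.
have /(eval2_null y z) := allP (weighted_sum_table star) c cc.
rewrite eval2D => /eqP; rewrite addr_eq0 => /eqP E.
transitivity (eval2 y z (weighted_sum star c)).
  by rewrite eval2_sum; apply: eq_bigr => e _; rewrite eval2Z eval2_piece zr_nat.
by rewrite E /= !mulr0 !addr0 rmorphN opprK rmorph_nat.
Qed.

(** Four interior points of each cell, as integer homogeneous coordinates. *)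
Definition samples : seq (cell * vec3 Z) := Eval vm_compute in
  flatten [seq [seq (c, (foldr (fun (e : Z * vec3 Z) u =>
       (Z.add (Z.mul e.1 e.2.1.1) u.1.1, Z.add (Z.mul e.1 e.2.1.2) u.1.2,
        Z.add (Z.mul e.1 e.2.2) u.2)) (Z0, Z0, Z0) (zip s (corners c)) : vec3 Z))
     | s : seq Z <- [:: [:: 1; 1; 1]; [:: 2; 1; 1]; [:: 1; 2; 1]; [:: 1; 1; 2]]]
    | c <- cells].

Lemma samples_cells : all (fun p : cell * vec3 Z =>
  (p.1 \in cells) && (0 < p.2.1.1 + p.2.1.2 + p.2.2) &&
  all (fun l => 0 < dot l p.2) (sides p.1)) samples.
Proof. by vm_compute. Qed.

Definition sample (p : cell * vec3 Z) (e : nat * seq nat) : Z :=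
  Z.mul (Z.of_nat e.1) (zpiece p.2 (around p.1) 5 e.2).

Definition zdot (r s : seq Z) : Z :=
  foldr (fun e : Z * Z => Z.add (Z.mul e.1 e.2)) Z0 (zip r s).

(** A prime modulo which the sampling matrices of all six bases keep full rank. *)
Definition prime31 : Z := 31.
Definition zmod (a : Z) : Z := Z.modulo a prime31.

Definition inv31 (a : Z) : Z :=
  head Z0 [seq k <- [seq Z.of_nat i | i <- iota 1 30] | Z.eqb (zmod (Z.mul a k)) 1].

Fixpoint pivot (seen todo : seq (seq Z)) : seq Z * seq (seq Z) :=
  if todo is r :: todo' then
    if Z.eqb (head Z0 r) Z0 then pivot (r :: seen) todo' else (r, catrev seen todo')
  else ([::], seen).

(** Gauss-Jordan elimination modulo 31. It finds a candidate for the left inverse, which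
the product with the original matrix certifies. *)
Fixpoint eliminate (n : nat) (done todo : seq (seq Z)) : seq (seq Z) :=
  if n is n'.+1 then
    let (r, rest) := pivot [::] todo in
    let k := inv31 (head Z0 r) in
    let r' := [seq zmod (Z.mul k x) | x <- behead r] in
    let reduce s := let h := Z.opp (head Z0 s) in
      [seq zmod (Z.add e.1 (Z.mul h e.2)) | e <- zip (behead s) r'] in
    eliminate n' (rcons (map reduce done) r') (map reduce rest)
  else done.

(** The six bases share most of their functions, so all of them are sampled once. *)
Definition sample_table : seq (seq nat * seq Z) := Eval vm_compute in
  [seq (m, [seq zpiece p.2 (around p.1) 5 m | p <- samples])
  | m <- undup [seq e.2 | e <- flatten [seq splines star | star <- [:: Ba; Bb; Bc; Bd; Be; Bf]]]].

Lemma sample_table_ok : all (fun r : seq nat * seq Z =>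
  r.2 == [seq zpiece p.2 (around p.1) 5 r.1 | p <- samples]) sample_table.
Proof. by vm_compute. Qed.

Definition lookup (m : seq nat) : seq Z :=
  (nth ([::], [::]) sample_table (find (fun r => r.1 == m) sample_table)).2.

Lemma lookup_ok star : all (fun e : nat * seq nat =>
  has (fun r => r.1 == e.2) sample_table) (splines star).
Proof. by case: star; vm_compute. Qed.

Definition columns (star : basis_name) : seq (seq Z) :=
  [seq [seq Z.mul (Z.of_nat e.1) x | x <- lookup e.2] | e <- splines star].

Lemma columnsE star : columns star = [seq [seq sample p e | p <- samples] | e <- splines star].
Proof.
apply/eq_in_map => e /(allP (lookup_ok star)) he.
have := nth_find ([::], [::]) he; rewrite /= => /eqP mE.
have := mem_nth ([::], [::]) (_ : find (fun r => r.1 == e.2) sample_table < size sample_table)%N.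
rewrite -has_find => /(_ he)/(allP sample_table_ok)/eqP; rewrite mE -/(lookup _) => ->.
by rewrite -map_comp.
Qed.

Definition left_inverse (cols : seq (seq Z)) : seq (seq Z) :=
  eliminate (size cols) [::]
    [seq [seq zmod (nth Z0 c i) | c <- cols] ++
         [seq if i == j then Zpos xH else Z0 | j <- iota 0 (size samples)]
    | i <- iota 0 (size samples)].

Definition left_inverse_ok (B A : seq (seq Z)) : bool :=
  all (fun i => all (fun j =>
    Z.eqb (zmod (zdot (nth [::] B i) (nth [::] A j))) (if i == j then Zpos xH else Z0))
   (iota 0 39)) (iota 0 39).

(** The functions of each basis are linearly independent, in the strong form that
the sampling matrix is left invertible modulo 31. *)
Lemma left_inverse_table star :
  let A := columns star in left_inverse_ok (left_inverse A) A.
Proof. case: star; by vm_compute. Qed.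

(** * Stability of the coefficients *)

(** The determinant is 1 modulo 31. *)
Lemma det_mod (n : nat) (G : 'M[Z]_n) :
  (forall i j, zmod (G i j) = if i == j then Zpos xH else Z0) -> \det G != 0.
Proof.
move=> GE.
have GI : map_mx (zr 'F_31) G = 1%:M.
  apply/matrixP => i j; rewrite !mxE [G i j](Z.div_mod _ prime31) //.
  rewrite zrD zrM (_ : zr _ prime31 = 0) ?mul0r ?add0r; last by apply/eqP.
  by rewrite [Z.modulo _ _]GE; case: eqP => _; [exact: zr1 | exact: zr0].
apply/negP => /eqP G0; have := det_map_mx (zr 'F_31) G.
by rewrite GI det1 G0 rmorph0 => /eqP; rewrite oner_eq0.
Qed.

Section Stability.
Context {R : realType}.

Lemma zr_eq0 (z : Z) : (zr R z == 0) = (z == 0).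
Proof.
apply/eqP/eqP => [|->]; last exact: rmorph0.
case: z => // p; have := @zr_gt0 R (Zpos p) isT; first by move=> /lt0r_neq0/eqP.
move=> /lt0r_neq0; rewrite -[Zneg p]/(- (Zpos p)) rmorphN => + /eqP.
by rewrite oppr_eq0 => /negbTE ->.
Qed.

Definition nth_spline star (k : 'I_39) := nth (0, [::])%N (splines star) k.

Definition combination star (cl : cell) (b : vec3 R) (c : 'I_39 -> R) : R :=
  \sum_k c k * ((nth_spline star k).1%:R / 4 * value b (around cl) 5 (nth_spline star k).2).

Lemma zdotE (r : seq Z) (a : cell * vec3 Z -> Z) ps :
  zr R (zdot r [seq a p | p <- ps]) = \sum_(e <- zip r ps) zr R e.1 * zr R (a e.2).
Proof.
rewrite /zdot; elim: r ps => [|x r IH] [|p ps] /=; rewrite ?big_nil; try exact: zr0.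
by rewrite big_cons zrD zrM IH.
Qed.

(** The integer samples are the values at the point with barycentric coordinates
p.2 / N, up to the factor N ^ 5 due to homogeneity and the factor 4 of the weights. *)
Lemma sample_value p e : p \in samples ->
  let N : R := zr R (p.2.1.1 + p.2.1.2 + p.2.2) in
  [/\ 0 < N, open_cell p.1 (N^-1 *: (zr3 R p.2 : R * R * R)),
      p.1 \in cells &
   zr R (sample p e) = 4 * N ^+ 5 *
     (e.1%:R / 4 * value (N^-1 *: (zr3 R p.2 : R * R * R)) (around p.1) 5 e.2)].
Proof.
move=> ps N; have /allP/(_ _ ps) /andP[/andP[pc pN] /allP po] := samples_cells.
have N0 : 0 < N by exact: zr_gt0.
split => // [l /po lp|].
  rewrite dotC dotZl dotC dot_zr3; apply: mulr_gt0; rewrite ?invr_gt0 //; exact: zr_gt0.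
rewrite valueZ exprVn /sample -zpieceE.
rewrite zrM zr_nat.
move: (zr R (zpiece _ _ _ _)) => v; clearbody N; field. exact: lt0r_neq0.
Qed.

(** With G = B A invertible, c = G^-1 B (A c), and the entries of A c are multiples of
values of the combination in the open cells. *)
Lemma stability star : exists2 K : R, 0 < K &
  forall (c : 'I_39 -> R) (M : R), 0 <= M ->
    (forall cl b, cl \in cells -> open_cell cl b -> b.1.1 + b.1.2 + b.2 = 1 ->
      `|combination star cl b c| <= M) ->
  forall k, `|c k| <= K * M.
Proof.
pose A := columns star; pose B := left_inverse A.
pose G : 'M[Z]_39 := \matrix_(i, j) zdot (nth [::] B i) (nth [::] A j).
have G0 : \det G != 0.
  apply: det_mod => i j; rewrite mxE.
  have /allP/(_ (i : nat)) := left_inverse_table star.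
  rewrite mem_iota ltn_ord => /(_ isT)/allP/(_ (j : nat)).
  by rewrite mem_iota ltn_ord => /(_ isT)/Z.eqb_eq.
pose H := invmx (map_mx (zr R) G).
have HG : H *m map_mx (zr R) G = 1%:M.
  by rewrite mulVmx // unitmxE det_map_mx unitfE zr_eq0.
pose N (p : cell * vec3 Z) : R := zr R (p.2.1.1 + p.2.1.2 + p.2.2).
pose C (i : 'I_39) : R := \sum_(e <- zip (nth [::] B i) samples) `|zr R e.1| * `|4 * N e.2 ^+ 5|.
have C_ge0 i : 0 <= C i by apply: sumr_ge0 => e _; apply: mulr_ge0.
(* The summand 1 only makes the constant positive. *)
exists (1 + \sum_k \sum_i `|H k i| * C i).
  rewrite ltr_pwDl //; apply: sumr_ge0 => k _; apply: sumr_ge0 => i _; exact: mulr_ge0.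
move=> c M M0 hM k.
pose Y (p : cell * vec3 Z) : R := \sum_j c j * zr R (sample p (nth_spline star j)).
have Yle p : p \in samples -> `|Y p| <= `|4 * N p ^+ 5| * M.
  move=> ps; pose b : vec3 R := (N p)^-1 *: (zr3 R p.2 : R * R * R).
  have [N0 bo pc _] := sample_value (0, [::])%N ps.
  have -> : Y p = 4 * N p ^+ 5 * combination star p.1 b c.
    rewrite /Y mulr_sumr; apply: eq_bigr => j _.
    have [_ _ _ ->] := sample_value (nth_spline star j) ps.
    by rewrite mulrCA.
  rewrite normrM; apply: ler_wpM2l => //; apply: hM => //.
  have NE : N p = zr R p.2.1.1 + zr R p.2.1.2 + zr R p.2.2 by rewrite /N !rmorphD.
  by rewrite /b /= -!mulrDr -NE mulVf //; exact: lt0r_neq0.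
have GY i : \sum_j map_mx (zr R) G i j * c j =
    \sum_(e <- zip (nth [::] B i) samples) zr R e.1 * Y e.2.
  transitivity (\sum_j \sum_(e <- zip (nth [::] B i) samples)
    c j * (zr R e.1 * zr R (sample e.2 (nth_spline star j)))).
    apply: eq_bigr => j _; rewrite !mxE mulrC -mulr_sumr; congr (_ * _).
    by rewrite /A columnsE (nth_map (0, [::])%N) ?size_splines // zdotE.
  rewrite exchange_big /=; apply: eq_bigr => e _; rewrite mulr_sumr.
  by apply: eq_bigr => j _; rewrite mulrCA.
have -> : c k = \sum_i H k i * \sum_j map_mx (zr R) G i j * c j.
  have : (H *m map_mx (zr R) G *m \col_j c j) k ord0 = c k by rewrite HG mul1mx mxE.
  rewrite -mulmxA mxE => <-; apply: eq_bigr => i _; congr (_ * _).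
  by rewrite mxE; apply: eq_bigr => j _; rewrite [X in _ * X = _]mxE.
apply: le_trans (_ : \sum_i `|H k i| * C i * M <= _).
  apply: le_trans (ler_norm_sum _ _ _) _; apply: ler_sum => i _.
  rewrite normrM -mulrA; apply: ler_wpM2l => //; rewrite GY.
  apply: le_trans (ler_norm_sum _ _ _) _; rewrite mulr_suml big_seq [leRHS]big_seq.
  apply: ler_sum => e /mem_zip[_ es]; rewrite normrM -mulrA; apply: ler_wpM2l => //.
  exact: Yle.
rewrite -mulr_suml; apply: ler_wpM2r => //.
rewrite [X in _ <= 1 + X](bigD1 k) //= addrCA ler_wpDr // addr_ge0 // sumr_ge0 // => i _.
by apply: sumr_ge0 => j _; exact: mulr_ge0.
Qed.
End Stability.

(** * Convex hulls in barycentric coordinates *)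

Section Geometry.
Context {R : realType}.
Variables v1 v2 v3 : R * R.
Local Notation v := (split12 v1 v2 v3).
Local Notation D := (orient v1 v2 v3).
Local Notation lambda := (@lebesgue_measure R).
Local Notation mu2 := (lambda \x lambda)%E.

Lemma fstD (p q : R * R) : (p + q).1 = p.1 + q.1. Proof. by []. Qed.
Lemma sndD (p q : R * R) : (p + q).2 = p.2 + q.2. Proof. by []. Qed.
Lemma fstZ (k : R) (p : R * R) : (k *: p).1 = k * p.1. Proof. by []. Qed.
Lemma sndZ (k : R) (p : R * R) : (k *: p).2 = k * p.2. Proof. by []. Qed.
Definition pairE := (fstD, sndD, fstZ, sndZ).

Lemma pair_eq (p q : R * R) : p.1 = q.1 -> p.2 = q.2 -> p = q.
Proof. by case: p q => [p1 p2] [q1 q2] /= -> ->. Qed.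

Lemma fst_sum I (s : seq I) (F : I -> R * R) : (\sum_(i <- s) F i).1 = \sum_(i <- s) (F i).1.
Proof. by elim: s => [|i s IH]; rewrite ?big_nil // !big_cons fstD IH. Qed.
Lemma snd_sum I (s : seq I) (F : I -> R * R) : (\sum_(i <- s) F i).2 = \sum_(i <- s) (F i).2.
Proof. by elim: s => [|i s IH]; rewrite ?big_nil // !big_cons sndD IH. Qed.

Definition node (i : nat) : R * R := v (inord i).

Definition bary_coords (x : R * R) : vec3 R :=
  (orient x v2 v3 / D, orient v1 x v3 / D, orient v1 v2 x / D).

Local Notation coords := bary_coords.

(** The vertices v7, ..., v10 never carry knots. *)
Lemma sum10 (V : zmodType) (F : 'I_10 -> V) : (forall j : 'I_10, (6 <= j)%N -> F j = 0) ->
  \sum_j F j = \sum_(j <- iota 0 6) F (inord j).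
Proof.
move=> F0; transitivity (\sum_(j < 10) F (inord j)).
  by apply: eq_bigr => j _; rewrite inord_val.
rewrite -(big_mkord xpredT (fun j => F (inord j))) (@big_cat_nat _ _ _ 6) //=.
have -> : \sum_(6 <= j < 10) F (inord j) = 0.
  rewrite big_nat big1 // => j /andP[j6 j10].
  by apply: F0; rewrite inordK.
by rewrite addr0.
Qed.

Hypothesis D0 : D != 0.

Lemma coords_sum x : (coords x).1.1 + (coords x).1.2 + (coords x).2 = 1.
Proof. by rewrite /= /orient; field. Qed.

Lemma coordsK x :
  x = (coords x).1.1 *: v1 + (coords x).1.2 *: v2 + (coords x).2 *: v3.
Proof. by apply: pair_eq; rewrite !pairE /= /orient; field. Qed.

Lemma coords_comb (a b c : R) (x : R * R) : a + b + c = 1 ->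
  x = a *: v1 + b *: v2 + c *: v3 -> coords x = (a, b, c).
Proof.
move=> abc ->; rewrite /bary_coords /orient !pairE.
have -> : c = 1 - a - b by rewrite -abc; ring.
by congr (_, _, _); field.
Qed.

Lemma coords_inj : injective coords.
Proof. by move=> x y xy; rewrite (coordsK x) (coordsK y) xy. Qed.

(** Each linear form in the barycentric coordinates is an affine function on the
plane. *)
Lemma coords_affine (I : Type) (s : seq I) (beta : I -> R) (w : I -> R * R) :
  \sum_(i <- s) beta i = 1 ->
  coords (\sum_(i <- s) beta i *: w i) = \sum_(i <- s) beta i *: (coords (w i) : R * R * R).
Proof.
move=> s1; apply: dot_inj => u.
pose a := (u.1.1 * (v2.2 - v3.2) + u.1.2 * (v3.2 - v1.2) + u.2 * (v1.2 - v2.2)) / D.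
pose b := (u.1.1 * (v3.1 - v2.1) + u.1.2 * (v1.1 - v3.1) + u.2 * (v2.1 - v1.1)) / D.
pose e := (u.1.1 * (v2.1 * v3.2 - v2.2 * v3.1) + u.1.2 * (v3.1 * v1.2 - v3.2 * v1.1) +
  u.2 * (v1.1 * v2.2 - v1.2 * v2.1)) / D.
have aff x : dot (coords x) u = a * x.1 + b * x.2 + e.
  by rewrite /a /b /e /dot /bary_coords /orient /=; ring.
rewrite ![dot u _]dotC dot_suml aff fst_sum snd_sum -[e]mul1r -s1 !mulr_sumr mulr_suml.
rewrite -!big_split; apply: eq_bigr => i _; rewrite aff fstZ sndZ /=; ring.
Qed.

Lemma node_coords j : (j < 6)%N -> coords (node j) = vertexR j.
Proof.
move=> j6; have j10 : (j < 10)%N by exact: leq_trans j6 _.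
suff [s1 E] : (vertexR j).1.1 + (vertexR j).1.2 + (vertexR j).2 = 1 :> R /\
    node j = (vertexR j).1.1 *: v1 + (vertexR j).1.2 *: v2 + (vertexR j).2 *: v3.
  by rewrite (coords_comb s1 E); case: (vertexR j) => -[].
have zr2 : zr R 2%:R = 2 by exact: rmorph_nat.
rewrite /node /split12 inordK //.
have explicit (x y z : Z) (p : R * R) : zr R x + zr R y + zr R z = 2 ->
    2 *: p = zr R x *: v1 + zr R y *: v2 + zr R z *: v3 ->
  let w : vec3 R := 2^-1 *: (zr3 R (x, y, z) : R * R * R) in
  w.1.1 + w.1.2 + w.2 = 1 /\ p = w.1.1 *: v1 + w.1.2 *: v2 + w.2 *: v3.
  move=> s1 pE /=; split; first by rewrite -!mulrDr s1 mulVf.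
  by rewrite -!scalerA -!scalerDr -pE scalerA mulVf // scale1r.
case: j j6 {j10} => [|[|[|[|[|[|//]]]]]] _; apply: explicit; rewrite /= ?zr2 ?zr1 ?zr0;
  by [ring | apply: pair_eq; rewrite !pairE; field].
Qed.

Lemma barycentricP m x beta : size m = 6%N ->
  barycentric v (knots_of_seq m) x beta <->
  [/\ coords x = \sum_(j <- iota 0 6) beta (inord j) *: (vertexR j : R * R * R),
      \sum_(j <- iota 0 6) beta (inord j) = 1,
     forall j, (j < 6)%N -> nth 0%N m j = 0%N -> beta (inord j) = 0 &
     forall j : 'I_10, (6 <= j)%N -> beta j = 0].
Proof.
move=> sm; split.
  case=> xE b1 b0.
  have b6 (j : 'I_10) : (6 <= j)%N -> beta j = 0.
    by move=> j6; apply: b0; rewrite ffunE nth_default ?sm.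
  have s1 : \sum_(j <- iota 0 6) beta (inord j) = 1 by rewrite -sum10.
  split => //; last first.
    by move=> j j6 mj; apply: b0; rewrite ffunE inordK // (leq_trans j6).
  rewrite xE sum10; last by move=> j /b6 ->; rewrite scale0r.
  rewrite coords_affine //; apply: eq_big_seq => j; rewrite mem_iota /= => j6.
  by rewrite -node_coords.
case=> cx s1 b0 b6; split; first last.
- move=> j; rewrite ffunE; have [j6 mj|j6 _] := ltnP j 6; last exact: b6.
  by rewrite -[j]inord_val; apply: b0.
- by rewrite sum10.
apply: coords_inj; rewrite cx sum10; last by move=> j /b6 ->; rewrite scale0r.
rewrite coords_affine //; apply: eq_big_seq => j; rewrite mem_iota /= => j6.
by rewrite -node_coords.
Qed.

Lemma hullP m x : size m = 6%N ->
  hull v (knots_of_seq m) x <-> exists beta : nat -> R,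
  [/\ coords x = \sum_(j <- iota 0 6) beta j *: (vertexR j : R * R * R),
      \sum_(j <- iota 0 6) beta j = 1,
     forall j, (j < 6)%N -> nth 0%N m j = 0%N -> beta j = 0 &
     forall j, (j < 6)%N -> 0 <= beta j].
Proof.
move=> sm; split => [[beta /(barycentricP _ _ sm)[cx s1 b0 b6] b_ge0]|[beta [cx s1 b0 b_ge0]]].
  by exists (fun j => beta (inord j)); split.
exists (fun j : 'I_10 => if (j < 6)%N then beta j else 0); last first.
  by move=> j; case: ifP => // /b_ge0.
have E j : j \in iota 0 6 -> (if (@inord 9 j < 6)%N then beta (@inord 9 j) else 0) = beta j.
  by rewrite mem_iota /= => j6; rewrite inordK ?j6 // (leq_trans j6).
apply/(barycentricP _ _ sm); split.
- by rewrite cx; apply: eq_big_seq => j /E ->.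
- by rewrite -s1; apply: eq_big_seq => j /E ->.
- by move=> j j6 /(b0 _ j6) bj; rewrite E ?mem_iota.
- by move=> j; rewrite leqNgt => /negbTE ->.
Qed.

Lemma hull_form_ge0 m x (l : vec3 R) : size m = 6%N -> hull v (knots_of_seq m) x ->
  (forall j, (j < 6)%N -> (0 < nth 0%N m j)%N -> 0 <= dot l (vertexR j)) ->
  0 <= dot l (coords x).
Proof.
move=> sm /(hullP _ sm)[beta [-> _ b0 b_ge0]] lm.
rewrite dotC dot_suml big_seq; apply: sumr_ge0 => j; rewrite mem_iota /= => j6.
have [/(b0 _ j6) ->|mj] := posnP (nth 0%N m j); first by rewrite mul0r.
by apply: mulr_ge0; [exact: b_ge0 | rewrite dotC; exact: lm].
Qed.

(** The triangle spanned by the three points of the frame. *)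
Definition frame_hull (f : frame) : set (R * R) :=
  [set x | forall e, e \in f.1 -> 0 <= dot (zr3 R e.2) (coords x)].

Lemma dot1_coords x : dot (1, 1, 1) (coords x) = 1.
Proof. by rewrite /dot !mul1r coords_sum. Qed.

Lemma frame_forms_sum f x : f \in frames ->
  \sum_(e <- f.1) dot (zr3 R e.2) (coords x) = 1.
Proof.
move=> ff; have df := allP frames_dual f ff.
rewrite -(dot1_coords x) (frame_combination _ _ df); apply: eq_big_seq => e ef.
have /andP[/allP h _] := df.
by rewrite -node_coords ?h // dot1_coords mulr1.
Qed.

Lemma frame_barycenter f x : f \in frames ->
  x = \sum_(e <- f.1) dot (zr3 R e.2) (coords x) *: node e.1.
Proof.
move=> ff; have df := allP frames_dual f ff; have /andP[/allP h _] := df.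
apply: coords_inj; rewrite coords_affine ?frame_forms_sum //.
rewrite {1}(frame_coordinates (coords x) df); apply: eq_big_seq => e ef.
by rewrite node_coords ?h.
Qed.

Lemma frame_hull_sub m f : f \in frames -> size m = 6%N -> covers m f ->
  frame_hull f `<=` hull v (knots_of_seq m).
Proof.
move=> ff sm /allP fm x xf; apply/(hullP _ sm).
have df := allP frames_dual f ff; have /andP[/allP h _] := df.
have pick (V : lmodType R) (W : nat -> V) :
   \sum_(j <- iota 0 6) (\sum_(e <- f.1 | e.1 == j) dot (zr3 R e.2) (coords x)) *: W j =
   \sum_(e <- f.1) dot (zr3 R e.2) (coords x) *: W e.1.
  under eq_bigr do rewrite scaler_suml big_mkcond.
  rewrite exchange_big /=; apply: eq_big_seq => e ef.
  have e6 : e.1 \in iota 0 6 by rewrite mem_iota h.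
  rewrite (bigD1_seq e.1 e6 (iota_uniq 0 6)) /= eqxx big1 ?addr0 // => j.
  by rewrite eq_sym => /negbTE ->.
(* The coefficient of v_j is the form of the frame at v_j, or 0 if v_j is not in it. *)
exists (fun j => \sum_(e <- f.1 | e.1 == j) dot (zr3 R e.2) (coords x)); split.
- by rewrite pick -frame_coordinates.
- rewrite -(frame_forms_sum x ff).
  transitivity (\sum_(j <- iota 0 6)
    (\sum_(e <- f.1 | e.1 == j) dot (zr3 R e.2) (coords x)) *: (1 : R^o)).
    by apply: eq_bigr => j _; rewrite [RHS]mulr1.
  by rewrite (pick R^o (fun=> 1)); apply: eq_bigr => e _; rewrite [LHS]mulr1.
- move=> j j6 mj; rewrite big_seq_cond big1 // => e /andP[/fm + /eqP ej].
  by rewrite ej mj.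
- by move=> j _; rewrite big_seq_cond; apply: sumr_ge0 => e /andP[/xf].
Qed.

(** What identifies the hull of three knots that cover a frame, and its area. *)
Lemma frames_table :
  all (fun f : frame => if f.1 is [:: e1; e2; e3] then
    [&& Z.mul f.2 (Z.abs (dot (vertex e1.1) (cross (vertex e2.1) (vertex e3.1)))) == Zpos 8,
        all (fun e : nat * vec3 Z =>
          all (fun e' : nat * vec3 Z => 0 <= dot e.2 (vertex e'.1)) f.1) f.1 &
        all (fun m => covers m f ==>
            all (fun j => (0 < nth 0%N m j)%N ==> (j \in map fst f.1)) (iota 0 6))
          (compositions 6 3)]
    else false) frames.
Proof. by vm_compute. Qed.

Lemma hull_frame m f : f \in frames -> size m = 6%N -> sumn m = 3%N -> covers m f ->
  hull v (knots_of_seq m) = frame_hull f.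
Proof.
move=> ff sm wm fm; apply/seteqP; split; last exact: frame_hull_sub.
move=> x xm e ef; apply: hull_form_ge0 xm _ => // j j6 mj.
have := allP frames_table f ff; case: f ff fm ef => -[|e1 [|e2 [|e3 []]]] // d ff fm ef.
move=> /and3P[_ /allP/(_ _ ef)/allP hn /allP/(_ m)].
rewrite mem_compositions // => /(_ isT)/implyP/(_ fm)/allP/(_ j).
rewrite mem_iota j6 mj => /(_ isT)/mapP[e' /hn he' ->].
by rewrite dot_vertexR dot_zr3; apply: mulr_ge0 => //; exact: zr_ge0.
Qed.

(** Multiplicativity of the determinant: areas relative to T are determinants of
barycentric coordinates. *)
Lemma orient_coords p q r : orient p q r = D *
  ((coords p).1.1 * ((coords q).1.2 * (coords r).2 - (coords q).2 * (coords r).1.2)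
   + (coords p).1.2 * ((coords q).2 * (coords r).1.1 - (coords q).1.1 * (coords r).2)
   + (coords p).2 * ((coords q).1.1 * (coords r).1.2 - (coords q).1.2 * (coords r).1.1)).
Proof. by move: D0; rewrite /bary_coords /= /orient => N; field. Qed.

Lemma orient_comb (a b c : R) (p q r x : R * R) : a + b + c = 1 ->
  x = a *: p + b *: q + c *: r ->
  [/\ orient x q r = a * orient p q r, orient p x r = b * orient p q r
    & orient p q x = c * orient p q r].
Proof.
move=> abc ->; have -> : c = 1 - a - b by rewrite -abc; ring.
by rewrite /orient !pairE; split; ring.
Qed.

Lemma zr3_cross (a b : vec3 Z) : zr3 R (cross a b) = cross (zr3 R a) (zr3 R b).
Proof. by rewrite /zr3 /cross /= !rmorphB !rmorphM. Qed.

Lemma mu2_frame f : f \in frames ->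
  mu2 (frame_hull f) = ((`|D| / zr R f.2)%:E * mu2 unit_triangle)%E /\ 0 < zr R f.2.
Proof.
move=> ff; have := allP frames_table f ff; have := allP frames_dual f ff.
have xE := fun x => frame_barycenter x ff; have x1 := fun x => frame_forms_sum x ff.
case: f ff xE x1 => -[|e1 [|e2 [|e3 []]]] // d ff xE x1.
move=> /andP[/and4P[e1_6 e2_6 e3_6 _] _] /and3P[/eqP dE _ _].
set p := node e1.1; set q := node e2.1; set r := node e3.1.
set k := dot (vertex e1.1) _ in dE.
have oE : orient p q r = D * (zr R k / 8).
  have zrk : zr R k = dot (zr3 R (vertex e1.1))
      (cross (zr3 R (vertex e2.1)) (zr3 R (vertex e3.1))).
    by rewrite -zr3_cross dot_zr3.
  rewrite orient_coords !node_coords // zrk; congr (_ * _).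
  have c1 i : (@vertexR R i).1.1 = 2^-1 * (zr3 R (vertex i)).1.1 by [].
  have c2 i : (@vertexR R i).1.2 = 2^-1 * (zr3 R (vertex i)).1.2 by [].
  have c3 i : (@vertexR R i).2 = 2^-1 * (zr3 R (vertex i)).2 by [].
  by rewrite !c1 !c2 !c3 /dot [cross]lock /= -lock /cross /=; field.
have dk : zr R d * `|zr R k| = 8.
  have zr8 : zr R (Zpos 8) = 8 by exact: (rmorph_nat (zr R) 8).
  rewrite -zr8 -dE [RHS](_ : _ = zr R d * zr R (Z.abs k)); last exact: rmorphM.
  congr (_ * _); case: (k) => [|n|n]; first by rewrite normr0.
    by rewrite gtr0_norm //; exact: zr_gt0.
  rewrite -[Zneg n]/(- Zpos n) rmorphN normrN gtr0_norm //; exact: zr_gt0.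
have d0 : 0 < zr R d.
  have : 0 < zr R d * `|zr R k| by rewrite dk.
  by rewrite pmulr_lgt0 // normr_gt0; apply: contraTneq isT => k0; move/eqP: dk;
     rewrite k0 normr0 mulr0 eq_sym pnatr_eq0.
have kN : zr R k != 0.
  by apply/eqP => k0; move/eqP: dk; rewrite k0 normr0 mulr0 eq_sym pnatr_eq0.
have oN : orient p q r != 0.
  by rewrite oE mulf_neq0 // mulf_neq0 // invr_neq0 // pnatr_eq0.
split => //.
have -> : frame_hull ([:: e1; e2; e3], d) = closed_triangle p q r.
  have three (P : nat * vec3 Z -> Prop) :
      (forall e, e \in [:: e1; e2; e3] -> P e) <-> [/\ P e1, P e2 & P e3].
    split=> [h|[h1 h2 h3] e]; first by split; apply: h; rewrite !inE eqxx ?orbT.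
    by rewrite !inE => /or3P[] /eqP ->.
  apply/funext => x; apply/propext; rewrite -[frame_hull _ x]/(forall e,
    e \in [:: e1; e2; e3] -> 0 <= dot (zr3 R e.2) (coords x)) three.
  have := xE x; have := x1 x; rewrite !big_cons !big_nil !addr0 /closed_triangle /=.
  move: (dot (zr3 R e1.2) _) (dot (zr3 R e2.2) _) (dot (zr3 R e3.2) _) => a b c.
  rewrite !addrA => s1 sE; have [h1 h2 h3] := orient_comb s1 sE.
  by rewrite -/p -/q -/r h1 h2 h3 !mulfK.
rewrite mu2_closed_triangle // oE; congr (_%:E * _)%E.
rewrite normrM normf_div (ger0_norm (_ : 0 <= 8)) //; congr (_ * _).
by apply: (mulfI (lt0r_neq0 d0)); rewrite mulfV ?lt0r_neq0 // mulrA dk mulfV // pnatr_eq0.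
Qed.
End Geometry.

(** * Simplex splines on a cell *)

Section Values.
Context {R : realType}.
Variables v1 v2 v3 : R * R.
Local Notation v := (split12 v1 v2 v3).
Local Notation D := (orient v1 v2 v3).
Local Notation lambda := (@lebesgue_measure R).
Local Notation mu2 := (lambda \x lambda)%E.
Local Notation coords := (bary_coords v1 v2 v3).
Local Notation frame_hull := (frame_hull v1 v2 v3).
Hypothesis D0 : D != 0.

Definition unit_area : R := fine (mu2 unit_triangle).

Lemma unit_areaE : mu2 unit_triangle = unit_area%:E.
Proof.
rewrite /unit_area fineK // ge0_fin_numE; first exact: mu2_unit_triangle_lty.
exact: ltW (mu2_unit_triangle_gt0).
Qed.

Lemma unit_area_gt0 : 0 < unit_area.
Proof. by rewrite -lte_fin -unit_areaE mu2_unit_triangle_gt0. Qed.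

Lemma area_frame f : f \in frames -> area (frame_hull f) = `|D| / zr R f.2 * unit_area.
Proof.
by move=> ff; have [E _] := mu2_frame D0 ff; rewrite /area [X in fine X]E unit_areaE.
Qed.

(** The frame v1, v2, v3. *)
Definition corner_frame : frame := head ([::], Z0) frames.

Lemma triangleE : triangle v = frame_hull corner_frame.
Proof.
rewrite -(@hull_frame _ v1 v2 v3 D0 [:: 1; 1; 1; 0; 0; 0]%N) //.
rewrite /triangle; congr hull; apply/ffunP => i; rewrite !ffunE.
by case: i => -[|[|[|[|[|[|[|[|[|[|]]]]]]]]]].
Qed.

Lemma area_triangle : area (triangle v) = `|D| * unit_area.
Proof.
rewrite triangleE area_frame //; congr (_ * _).
by rewrite [zr R _]zr1 divr1.
Qed.

Lemma triangleP x : triangle v x <->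
  [/\ 0 <= (coords x).1.1, 0 <= (coords x).1.2 & 0 <= (coords x).2].
Proof.
rewrite triangleE; split=> [h|[h1 h2 h3] e].
  have := (h (0%N, (Zpos 1, Z0, Z0)) isT, h (1%N, (Z0, Zpos 1, Z0)) isT,
    h (2%N, (Z0, Z0, Zpos 1)) isT).
  by rewrite /dot /zr3 /= !zr1 !zr0 !mul1r !mul0r !addr0 !add0r => -[[? ?] ?].
by rewrite !inE => /or3P[] /eqP ->; rewrite /dot /zr3 /= !zr1 !zr0 !mul1r !mul0r ?addr0 ?add0r.
Qed.

Lemma hull_sub_triangle m : size m = 6%N -> hull v (knots_of_seq m) `<=` triangle v.
Proof.
move=> sm x xm; apply/triangleP.
have v_ge0 j : (j < 6)%N -> [/\ 0 <= (@vertexR R j).1.1, 0 <= (@vertexR R j).1.2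
    & 0 <= (@vertexR R j).2].
  move=> j6; have : all (fun w : vec3 Z => [&& 0 <= w.1.1, 0 <= w.1.2 & 0 <= w.2]) vertices by [].
  move/(all_nthP (0, 0, 0))/(_ j j6) => /and3P[h1 h2 h3].
  by split; apply: mulr_ge0 => //; exact: zr_ge0.
have h (l : vec3 R) := @hull_form_ge0 _ v1 v2 v3 D0 m x l sm xm.
have := (h (1, 0, 0), h (0, 1, 0), h (0, 0, 1)).
rewrite /dot /= => -[[h1 h2] h3].
move: h1 h2 h3; rewrite !mul1r !mul0r !addr0 !add0r => h1 h2 h3.
split; [apply: h1|apply: h2|apply: h3] => j j6 _;
  by have [? ? ?] := v_ge0 j j6; rewrite !mul1r !mul0r ?addr0 ?add0r.
Qed.

(** The hull lies between the triangle of the frame, of positive area, and T, of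
finite area. *)
Lemma area_covers m f : f \in frames -> size m = 6%N -> covers m f ->
  area (hull v (knots_of_seq m)) != 0.
Proof.
move=> ff sm fm; apply: lt0r_neq0; rewrite /area fine_gt0 //; apply/andP; split.
  apply: lt_le_trans (le_mu2 (frame_hull_sub D0 ff sm fm)).
  have [-> d0] := mu2_frame D0 ff.
  by rewrite unit_areaE -EFinM lte_fin mulr_gt0 ?unit_area_gt0 ?divr_gt0 ?normr_gt0.
apply: le_lt_trans (le_mu2 (hull_sub_triangle sm)) _.
rewrite triangleE; have [-> _] := @mu2_frame _ v1 v2 v3 D0 corner_frame isT.
by rewrite unit_areaE -EFinM ltry.
Qed.

Lemma knots_rem_dec m j : (j < 6)%N ->
  knots_rem (knots_of_seq m) (inord j) = knots_of_seq (dec m j).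
Proof.
move=> j6; apply/ffunP => i; rewrite !ffunE nth_dec -val_eqE /= inordK //.
exact: leq_trans j6 _.
Qed.

Lemma outside_hull c x m : c \in cells -> open_cell c (coords x) -> size m = 6%N ->
  first_frame m (around c) = None -> ~ hull v (knots_of_seq m) x.
Proof.
move=> cc xc sm mN xm; have [l [lm lx]] := separation cc sm xc mN.
have : 0 <= dot (- l) (coords x).
  apply: hull_form_ge0 xm _ => // j j6 mj.
  by rewrite -scaleN1r dotZl mulN1r oppr_ge0 lm.
by rewrite -scaleN1r dotZl mulN1r oppr_ge0 leNgt lx.
Qed.

Lemma beta_of0 (K : knots) x j : K j = 0%N -> beta_of v K x j = 0.
Proof.
move=> Kj; rewrite /beta_of; have [[b hb]|nb] := pselect (exists b, barycentric v K x b).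
  have [_ _] : barycentric v K x (xget (fun=> 0) [set b | barycentric v K x b]).
    by apply: (xgetPex (fun=> 0) (P := [set b | barycentric v K x b])); exists b.
  exact.
by rewrite xgetPN // => b hb; apply: nb; exists b.
Qed.

(** The chosen coefficients [beta_of] are arbitrary, so [value_step] is needed at each
level. When no frame around the cell is covered, all terms vanish: the base case
by separation, the others because removing knots cannot create a frame. A hull of
area zero never contains a cell, so that clause of the definition agrees. *)
Lemma simplex_value c x n m : c \in cells -> open_cell c (coords x) ->
  size m = 6%N -> sumn m = (n + 3)%N ->
  simplex_spline_rec v n (knots_of_seq m) x = value (coords x) (around c) n m.
Proof.
move=> cc xc.
have fsc : around c \in map around cells by exact: map_f.
elim: n m => [|n IH] m sm wm; rewrite valueE [LHS]/=; have := first_frameP m (around c);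
  case E: first_frame => [f|] fP.
- have [fc fm] := fP; have ff := around_frames fsc fc.
  rewrite (negbTE (area_covers ff sm fm)) (hull_frame D0 ff sm wm fm) indicE mem_set.
    rewrite area_triangle area_frame // mul1r.
    have [_ d0] := mu2_frame D0 ff.
    have := unit_area_gt0; have : 0 < `|D| by rewrite normr_gt0.
    move: (`|D|) d0 => u d0 u0 a0; field.
    by rewrite !lt0r_neq0.
  move=> e ef; apply: (cell_ge0 cc xc).
  by have /allP/(_ _ fc)/allP/(_ _ ef) := allP cells_around _ cc.
- case: ifP => // _; rewrite indicE memNset ?mul0r //; exact: outside_hull E.
all: set beta := beta_of _ _ _.
all: have beta0 j : (j < 6)%N -> nth 0%N m j = 0%N -> beta (inord j) = 0
  by move=> j6 mj; apply: beta_of0; rewrite ffunE inordK // (leq_trans j6).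
all: have sumE : \sum_j beta j * simplex_spline_rec v n (knots_rem (knots_of_seq m) j) x =
   \sum_(j <- iota 0 6) beta (inord j) * value (coords x) (around c) n (dec m j).
1, 3: rewrite sum10; last by move=> j j6; rewrite /beta beta_of0 ?mul0r // ffunE nth_default ?sm.
1, 2: apply: eq_big_seq => j; rewrite mem_iota /= => j6;
  have [/(beta0 _ j6) ->|mj] := posnP (nth 0%N m j); rewrite ?mul0r //;
  by rewrite knots_rem_dec // IH ?size_dec ?sumn_dec ?sm // wm.
- have [fc fm] := fP; have ff := around_frames fsc fc.
  rewrite (negbTE (area_covers ff sm fm)) sumE (value_step (b := coords x) fsc sm) //.
  + by rewrite valueE E.
  + by rewrite wm addSnnS.
  + have : exists b, barycentric v (knots_of_seq m) x b.
      have xf : frame_hull f x.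
        move=> e ef; apply: (cell_ge0 cc xc).
        by have /allP/(_ _ fc)/allP/(_ _ ef) := allP cells_around _ cc.
      by have [b hb _] := frame_hull_sub D0 ff sm fm xf; exists b.
    by move=> /(xgetPex (fun=> 0))/(barycentricP D0 _ _ sm)[].
- case: ifP => // _; rewrite sumE big1 // => j _.
  by rewrite value_None ?mulr0 // first_frame_dec.
Qed.
End Values.

(** * Generic points and the continuous extension *)

Lemma vec3_eq (A : Type) (a b : vec3 A) :
  a.1.1 = b.1.1 -> a.1.2 = b.1.2 -> a.2 = b.2 -> a = b.
Proof. by case: a b => -[a1 a2] a3 [[b1 b2] b3] /= -> -> ->. Qed.

Section Generic.
Context {R : realType}.
Variables v1 v2 v3 : R * R.
Local Notation v := (split12 v1 v2 v3).
Local Notation D := (orient v1 v2 v3).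
Local Notation lambda := (@lebesgue_measure R).
Local Notation mu2 := (lambda \x lambda)%E.
Local Notation coords := (bary_coords v1 v2 v3).

Lemma line_negligible (a b : R * R) : mu2.-negligible (line a b).
Proof.
pose n := if a == b then (1, 0) else (b.2 - a.2, - (b.1 - a.1)).
exists [set p | n.1 * p.1 + n.2 * p.2 = n.1 * a.1 + n.2 * a.2]; split.
- exact: measurable_line.
- apply: mu2_line; rewrite /n; case: ifPn => [_|ab]; first by rewrite oner_eq0.
  rewrite -negb_and oppr_eq0 !subr_eq0; apply: contra ab => /andP[/eqP e2 /eqP e1].
  by apply/eqP/pair_eq.
- move=> x [t xE]; rewrite /n /=; case: eqP xE => [->|_] xE /=; rewrite xE !pairE; ring.
Qed.

Lemma ae_generic : {ae mu2, forall x, generic v x}.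
Proof.
have h (i j : nat) : {ae mu2, forall x, ~ line (v (inord i)) (v (inord j)) x}.
  rewrite /almost_everywhere; apply: negligibleS (line_negligible (v (inord i)) (v (inord j))).
  by move=> x /= /contrapT.
have : {ae mu2, forall x, forall i j : nat, ~ line (v (inord i)) (v (inord j)) x}.
  by apply: ae_foralln => i; apply: ae_foralln => j; exact: h.
apply: negligibleS => x /=; apply: contra_not => hx i j _.
by have := hx i j; rewrite !inord_val.
Qed.

Hypothesis D0 : D != 0.

Lemma on_line (p q : 'I_10) (t : R) x : (p < 6)%N -> (q < 6)%N ->
  coords x = (1 - t) *: (vertexR p : R * R * R) + t *: (vertexR q : R * R * R) ->
  line (v p) (v q) x.
Proof.
move=> p6 q6 xE; exists t; apply: (coords_inj D0).
have := @coords_affine _ v1 v2 v3 _ [:: (1 - t, p); (t, q)] fst (fun e => v e.2).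
rewrite !big_cons !big_nil !addr0 subrK => /(_ erefl) ->; rewrite xE.
by rewrite -(node_coords D0 p6) -(node_coords D0 q6) /node !inord_val.
Qed.

(** Each of the nine equalities would put x on the line through two of v1, ..., v6. *)
Lemma generic_off_lines x : generic v x ->
  let b := coords x in
  [/\ [/\ b.1.1 != 0, b.1.2 != 0 & b.2 != 0],
      [/\ b.1.1 != b.1.2, b.1.2 != b.2 & b.1.1 != b.2] &
      [/\ b.1.1 != b.1.2 + b.2, b.1.2 != b.1.1 + b.2 & b.2 != b.1.1 + b.1.2]].
Proof.
move=> gx; have := coords_sum D0 x.
have zr2 : zr R (Zpos 2) = 2 by exact: (rmorph_nat (zr R) 2).
have off p q (p10 : (p < 10)%N) (q10 : (q < 10)%N) (t : R) : (p < 6)%N -> (q < 6)%N -> p != q ->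
    let w := fun c : vec3 Z -> Z =>
      (1 - t) * (2^-1 * zr R (c (vertex p))) + t * (2^-1 * zr R (c (vertex q))) in
    [/\ (coords x).1.1 = w (fun u => u.1.1), (coords x).1.2 = w (fun u => u.1.2)
      & (coords x).2 = w (fun u => u.2)] -> False.
  move=> p6 q6 pq /= [e1 e2 e3]; apply: (gx (Ordinal p10) (Ordinal q10) pq).
  apply: (@on_line (Ordinal p10) (Ordinal q10) t) => //.
  exact: vec3_eq.
move: off; case: (coords x) => -[x1 x2] x3 /= off s1.
split; split; apply/eqP => E.
- apply: (off 1%N 2%N isT isT x3) => //=; rewrite zr0 zr2; split; lra.
- apply: (off 0%N 2%N isT isT x3) => //=; rewrite zr0 zr2; split; lra.
- apply: (off 0%N 1%N isT isT x2) => //=; rewrite zr0 zr2; split; lra.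
- apply: (off 2%N 3%N isT isT (x1 + x2)) => //=; rewrite zr0 zr1 zr2; split; lra.
- apply: (off 0%N 4%N isT isT (x2 + x3)) => //=; rewrite zr0 zr1 zr2; split; lra.
- apply: (off 1%N 5%N isT isT (x1 + x3)) => //=; rewrite zr0 zr1 zr2; split; lra.
- apply: (off 3%N 5%N isT isT (2 * x3)) => //=; rewrite zr0 zr1; split; lra.
- apply: (off 3%N 4%N isT isT (2 * x3)) => //=; rewrite zr0 zr1; split; lra.
- apply: (off 4%N 5%N isT isT (2 * x1)) => //=; rewrite zr0 zr1; split; lra.
Qed.

(** The order of the coordinates and the comparison of the largest with the sum of the
two others determine the cell. *)
Lemma generic_cell x : triangle v x -> generic v x ->
  exists2 c, c \in cells & open_cell c (coords x).
Proof.
move=> /(triangleP D0) + /generic_off_lines; have := coords_sum D0 x.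
have pos (y : R) : 0 <= y -> y != 0 -> 0 < y by move=> y0 yN; rewrite lt0r yN.
case: (coords x) => -[x1 x2] x3 /= s1 [h1 h2 h3].
move=> [[/(pos _ h1) {}h1 /(pos _ h2) {}h2 /(pos _ h3) {}h3] [n1 n2 n3] [n4 n5 n6]].
have zN1 : zr R (Zneg 1) = -1 by exact: (rmorphN1 (zr R)).
have pick k : (k < 12)%N -> open_cell (nth ([::],[::],[::]) cells k) (x1, x2, x3) ->
   exists2 c, c \in cells & open_cell c (x1, x2, x3).
  by move=> k12; exists (nth ([::],[::],[::]) cells k) => //; exact: mem_nth.
have cell3 l1 l2 l3 gs fs : 0 < dot (zr3 R l1) (x1, x2, x3) -> 0 < dot (zr3 R l2) (x1, x2, x3) ->
  0 < dot (zr3 R l3) (x1, x2, x3) -> open_cell ([:: l1; l2; l3], gs, fs) (x1, x2, x3).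
  by move=> ? ? ? l; rewrite !inE => /or3P[] /eqP ->.
have [h12|h12] := orP (lt_total n1); have [h23|h23] := orP (lt_total n2).
- have [h|h] := orP (lt_total n6).
  + apply: (pick 11%N isT); apply: cell3; rewrite /dot /zr3 /= ?zr0 ?zr1 ?zN1; lra.
  + apply: (pick 10%N isT); apply: cell3; rewrite /dot /zr3 /= ?zr0 ?zr1 ?zN1; lra.
- have [h13|h13] := orP (lt_total n3); have [h|h] := orP (lt_total n5).
  + apply: (pick 9%N isT); apply: cell3; rewrite /dot /zr3 /= ?zr0 ?zr1 ?zN1; lra.
  + apply: (pick 8%N isT); apply: cell3; rewrite /dot /zr3 /= ?zr0 ?zr1 ?zN1; lra.
  + apply: (pick 5%N isT); apply: cell3; rewrite /dot /zr3 /= ?zr0 ?zr1 ?zN1; lra.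
  + apply: (pick 4%N isT); apply: cell3; rewrite /dot /zr3 /= ?zr0 ?zr1 ?zN1; lra.
- have [h13|h13] := orP (lt_total n3).
  + have [h|h] := orP (lt_total n6).
    * apply: (pick 7%N isT); apply: cell3; rewrite /dot /zr3 /= ?zr0 ?zr1 ?zN1; lra.
    * apply: (pick 6%N isT); apply: cell3; rewrite /dot /zr3 /= ?zr0 ?zr1 ?zN1; lra.
  + have [h|h] := orP (lt_total n4).
    * apply: (pick 3%N isT); apply: cell3; rewrite /dot /zr3 /= ?zr0 ?zr1 ?zN1; lra.
    * apply: (pick 2%N isT); apply: cell3; rewrite /dot /zr3 /= ?zr0 ?zr1 ?zN1; lra.
- have [h|h] := orP (lt_total n4).
  + apply: (pick 1%N isT); apply: cell3; rewrite /dot /zr3 /= ?zr0 ?zr1 ?zN1; lra.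
  + apply: (pick 0%N isT); apply: cell3; rewrite /dot /zr3 /= ?zr0 ?zr1 ?zN1; lra.
Qed.

Lemma dot_coords_continuous (l : vec3 R) : continuous (fun y => dot l (coords y)).
Proof.
pose a := (l.1.1 * (v2.2 - v3.2) + l.1.2 * (v3.2 - v1.2) + l.2 * (v1.2 - v2.2)) / D.
pose b := (l.1.1 * (v3.1 - v2.1) + l.1.2 * (v1.1 - v3.1) + l.2 * (v2.1 - v1.1)) / D.
pose e := (l.1.1 * (v2.1 * v3.2 - v2.2 * v3.1) + l.1.2 * (v3.1 * v1.2 - v3.2 * v1.1) +
  l.2 * (v1.1 * v2.2 - v1.2 * v2.1)) / D.
have -> : (fun y => dot l (coords y)) = (fun y : R * R => a * y.1 + b * y.2 + e).
  by apply/funext => y; rewrite /a /b /e /dot /bary_coords /orient /=; ring.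
move=> y; apply: cvgD; last exact: cvg_cst.
apply: cvgD; apply: cvgM; [exact: cvg_cst | exact: cvg_fst | exact: cvg_cst | exact: cvg_snd].
Qed.

Lemma value_continuous fs n m : continuous (fun y => value (coords y) fs n m).
Proof.
elim: n m => [|n IH] m y.
  have -> : (fun y => value (coords y) fs 0 m) = cst (value (coords y) fs 0 m).
    by apply/funext => z; exact: value0.
  exact: cvg_cst.
have -> : (fun y => value (coords y) fs n.+1 m) = (fun y =>
    if first_frame m fs is Some f then
      \sum_(e <- f.1) dot (zr3 R e.2) (coords y) * value (coords y) fs n (dec m e.1)
    else 0) by apply/funext => z; rewrite valueE.
case: first_frame => [f|]; last exact: cvg_cst.
elim: f.1 => [|e s IHs].
  by under eq_fun do rewrite big_nil; rewrite ?big_nil; exact: cvg_cst.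
under eq_fun do rewrite big_cons; rewrite ?big_cons.
by apply: cvgD => //; apply: cvgM; [exact: dot_coords_continuous | exact: IH].
Qed.

Lemma near_open_cell c x : open_cell c (coords x) ->
  \forall y \near x, open_cell c (coords y).
Proof.
rewrite /open_cell; elim: (sides c) => [|l s IH] h; first by near=> y => l.
have hl : \forall y \near x, 0 < dot (zr3 R l) (coords y).
  have hc := @dot_coords_continuous (zr3 R l) x.
  exact: (cvgr_gt _ hc _ (h l (mem_head _ _))).
have hs : \forall y \near x, forall l', l' \in s -> 0 < dot (zr3 R l') (coords y).
  by apply: IH => l' ls; apply: h; rewrite inE ls orbT.
near=> y => l'; rewrite inE => /predU1P[->|ls]; first by near: y.
by move: l' ls; near: y.
Unshelve. all: by end_near. Qed.

(** The generic values near x are those of a continuous function. *)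
Lemma spline_value c x m : c \in cells -> open_cell c (coords x) ->
  triangle v x -> generic v x -> size m = 6%N -> sumn m = 8%N ->
  simplex_spline v (knots_of_seq m) x = value (coords x) (around c) 5 m.
Proof.
move=> cc xc xT xg sm wm.
have gE y : simplex_spline_generic v (knots_of_seq m) y =
    simplex_spline_rec v 5 (knots_of_seq m) y.
  rewrite /simplex_spline_generic; congr (simplex_spline_rec v _ _ _).
  rewrite /knots_size; under eq_bigr do rewrite ffunE.
  have -> : (\sum_(i < 10) nth 0 m i = sumn m)%N.
    case: m sm {wm} => [|a [|b [|d [|e [|f [|g []]]]]]] // _.
    by rewrite !big_ord_recl big_ord0 /= ?nth_nil /=; lia.
  by rewrite wm.
rewrite /simplex_spline patchE mem_set //.
have pF : ProperFilter (within (triangle v `&` generic v) (nbhs x)).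
  by apply: within_nbhs_proper; apply: subset_closure; split.
apply: cvg_lim; first exact: norm_hausdorff.
apply: cvg_within_filter.
apply: cvg_trans; last exact: (@value_continuous (around c) 5 m x).
apply: near_eq_cvg; near=> y; rewrite gE (simplex_value D0 cc _ sm) //.
by near: y; exact: near_open_cell.
Unshelve. all: by end_near. Qed.

End Generic.

(** * Symmetries and the two bounds *)

(** If v1, v2, v3 are collinear, then T lies in a line, which is null. *)
Lemma orient_neq0 (R : realType) (v1 v2 v3 : R * R) :
  area (triangle (split12 v1 v2 v3)) != 0 -> orient v1 v2 v3 != 0.
Proof.
apply: contraNneq => D0.
(* A normal vector of a line through v1 that contains v2 and v3. *)
pose n : R * R := if v2 == v1 then if v3 == v1 then (1, 0)
    else (v3.2 - v1.2, - (v3.1 - v1.1)) else (v2.2 - v1.2, - (v2.1 - v1.1)).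
have normal (p : R * R) : p != v1 -> (p.2 - v1.2 != 0) || (- (p.1 - v1.1) != 0).
  rewrite -negb_and oppr_eq0 !subr_eq0; apply: contra => /andP[/eqP e2 /eqP e1].
  by apply/eqP/pair_eq.
have n0 : (n.1 != 0) || (n.2 != 0).
  by rewrite /n; case: ifPn => [_|/normal//]; case: ifPn => [_|/normal//]; rewrite oner_eq0.
have nE (w : R * R) : w \in [:: v1; v2; v3] ->
    n.1 * w.1 + n.2 * w.2 = n.1 * v1.1 + n.2 * v1.2.
  move: D0; rewrite /orient /n => D0.
  rewrite !inE => /or3P[] /eqP -> //; case: eqP => [e|_] /=; try case: eqP => [e'|_] /=;
    rewrite ?e ?e' //; lra.
rewrite /area; apply/eqP.
suff -> : (lebesgue_measure \x lebesgue_measure)%E (triangle (split12 v1 v2 v3)) = 0%E by [].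
apply/eqP; rewrite eq_le measure_ge0 andbT -(@mu2_line R n.1 n.2 (n.1 * v1.1 + n.2 * v1.2) n0).
apply: le_mu2 => x [beta [-> b1 b0] _] /=.
rewrite fst_sum snd_sum -[RHS]mul1r -b1 mulr_suml !mulr_sumr -big_split.
apply: eq_bigr => -[j jlt] _; rewrite fstZ sndZ.
have [j3|j3] := ltnP j 3; last first.
  by rewrite b0 ?ffunE ?nth_default //= !mul0r !mulr0 addr0.
rewrite -(nE (split12 v1 v2 v3 (Ordinal jlt))); first by rewrite /=; ring.
by case: j jlt j3 => [|[|[|//]]] jlt _; rewrite /split12 /= !inE eqxx ?orbT.
Qed.

Section Symmetry.
Context {R : realType}.
Variables v1 v2 v3 : R * R.
Local Notation v := (split12 v1 v2 v3).
Local Notation D := (orient v1 v2 v3).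
Hypothesis D0 : D != 0.

(** The barycentric coordinates of v1, ..., v10, multiplied by 12 to make them
integral. *)
Definition vertices10 : seq (vec3 Z) :=
  [:: (12, 0, 0); (0, 12, 0); (0, 0, 12); (6, 6, 0); (0, 6, 6); (6, 0, 6);
      (6, 3, 3); (3, 6, 3); (3, 3, 6); (4, 4, 4)].

Lemma split12_inj : injective v.
Proof.
have vE (i : 'I_10) : let w := nth (0, 0, 0) vertices10 i in
    bary_coords v1 v2 v3 (v i) = 12^-1 *: (zr3 R w : R * R * R).
  have explicit (x y z : Z) (p : R * R) : zr R x + zr R y + zr R z = 12 ->
      12 *: p = zr R x *: v1 + zr R y *: v2 + zr R z *: v3 ->
      bary_coords v1 v2 v3 p = 12^-1 *: (zr3 R (x, y, z) : R * R * R).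
    move=> s1 pE.
    rewrite (@coords_comb _ _ _ _ D0 (12^-1 * zr R x) (12^-1 * zr R y) (12^-1 * zr R z)) //.
      by rewrite -!mulrDr s1 mulVf.
    by rewrite -!scalerA -!scalerDr -pE scalerA mulVf // scale1r.
  have zrn n : zr R n%:R = n%:R by exact: rmorph_nat.
  have zr12 := zrn 12%N; have zr6 := zrn 6%N; have zr3' := zrn 3%N; have zr4 := zrn 4%N.
  have zr0 := zrn 0%N.
  move=> w; rewrite /w /split12; case: i {w} => -[|[|[|[|[|[|[|[|[|[|//]]]]]]]]]] ? /=;
    apply: explicit; rewrite ?zr12 ?zr6 ?zr3' ?zr4 ?zr0;
    by [ring | apply: pair_eq; rewrite !pairE; field].
have n12 : (12^-1 : R) != 0 by rewrite invr_eq0 pnatr_eq0.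
move=> i j vij; have := vE j; rewrite -vij vE => /(scalerI n12) E; apply/val_inj/eqP.
rewrite -(nth_uniq (0, 0, 0) (s := vertices10)) ?ltn_ord //; apply/eqP.
have zr_inj : injective (zr R).
  by move=> a b ab; apply/eqP; rewrite -subr_eq0 -(@zr_eq0 R) rmorphB subr_eq0; apply/eqP.
move: E; rewrite /zr3; case: (nth _ _ i) (nth _ _ j) => -[a1 a2] a3 [[b1 b2] b3] /=.
by case=> /zr_inj -> /zr_inj -> /zr_inj ->.
Qed.

(** The sum i + j identifies the pair {i, j} of distinct corners. *)
Definition midpoint (i j : nat) : nat := nth 0%N [:: 0; 3; 5; 4]%N (i + j).

Lemma midpointE (i j k : 'I_10) : (i < 3)%N -> (j < 3)%N -> i != j :> nat ->
  midpoint i j = k -> 2^-1 *: (v i + v j) = v k.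
Proof.
move: i j k => [i ilt] [j jlt] [k klt] /=.
case: i ilt => [|[|[|//]]] ilt _; case: j jlt => [|[|[|//]]] jlt //= _ _;
  rewrite /midpoint /= => E; move: klt; rewrite -E => klt; rewrite /split12 //=;
  by rewrite addrC.
Qed.

(** The affine map preserves midpoints and the vertices are distinct, so the
images of v1, v2, v3 determine those of v4, v5, v6. *)
Lemma symmetry_permute s : symmetry v s -> exists2 t, t \in symmetries &
  forall m, size m = 6%N -> knots_perm s (knots_of_seq m) = knots_of_seq (permute t m).
Proof.
case=> s3 [f [b sE]].
pose o (i : nat) : 'I_10 := inord i.
have oE i : (i < 10)%N -> o i = i :> nat by exact: inordK.
have mid (i j k : 'I_10) : (i < 3)%N -> (j < 3)%N -> i != j :> nat ->
    midpoint i j = k -> s k = midpoint (s i) (s j) :> nat.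
  move=> i3 j3 ij mk; have sij : s i != s j :> nat.
    by apply: contra ij => /eqP/val_inj/perm_inj ->.
  have m10 : (midpoint (s i) (s j) < 10)%N.
    by move: (s3 _ i3) (s3 _ j3); case: (s i) (s j) => -[|[|[|?]]] ? [[|[|[|?]]] ?].
  (* The map sends the midpoint of two corners to the midpoint of their images. *)
  rewrite (_ : s k = Ordinal m10) //; apply: split12_inj.
  rewrite -(@midpointE (s i) (s j) (Ordinal m10)) ?s3 // !sE -(midpointE i3 j3 ij mk).
  by rewrite linearZ linearD /=; apply: pair_eq; rewrite !pairE; field.
pose t := [seq (s (o i) : nat) | i <- iota 0 6].
have ts : t \in symmetries.
  have h0 : (s (o 0%N) < 3)%N by apply: s3; rewrite oE.
  have h1 : (s (o 1%N) < 3)%N by apply: s3; rewrite oE.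
  have h2 : (s (o 2%N) < 3)%N by apply: s3; rewrite oE.
  have n a c : (a < 10)%N -> (c < 10)%N -> a != c -> s (o a) != s (o c) :> nat.
    move=> a10 c10; apply: contra => /eqP/val_inj/perm_inj/(f_equal val) /=.
    by rewrite !oE // => ->.
  have n01 := n 0%N 1%N isT isT isT; have n02 := n 0%N 2%N isT isT isT.
  have n12 := n 1%N 2%N isT isT isT.
  have m01 : s (o 3%N) = midpoint (s (o 0%N)) (s (o 1%N)) :> nat by apply: mid; rewrite ?oE.
  have m12 : s (o 4%N) = midpoint (s (o 1%N)) (s (o 2%N)) :> nat by apply: mid; rewrite ?oE.
  have m02 : s (o 5%N) = midpoint (s (o 0%N)) (s (o 2%N)) :> nat by apply: mid; rewrite ?oE.
  rewrite /t /= m01 m12 m02; move: h0 h1 h2 n01 n02 n12; clear.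
  move: (s (o 0%N) : nat) (s (o 1%N) : nat) (s (o 2%N) : nat).
  by move=> [|[|[|?]]] [|[|[|?]]] [|[|[|?]]].
exists t => // m sm; apply/ffunP => i; rewrite !ffunE.
have tn j : (j < 6)%N -> nth 0%N t j = s (o j) by move=> j6; rewrite (nth_map 0%N) ?nth_iota.
have tlt : all (fun t => perm_eq t (iota 0 6)) symmetries by [].
have /perm_mem tmem := allP tlt t ts.
set j := (s^-1)%g i; have sj : s j = i by rewrite permKV.
have [i6|i6] := ltnP i 6.
  have it : (i : nat) \in t by rewrite tmem mem_iota.
  have k6 : (index (i : nat) t < 6)%N by rewrite -index_mem size_map size_iota in it.
  rewrite nth_mkseq //; congr nth.
  have E : s (o (index (i : nat) t)) = i by apply: val_inj; rewrite /= -tn // nth_index.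
  have -> : j = o (index (i : nat) t) by apply: (@perm_inj _ s); rewrite sj E.
  by rewrite oE // (leq_trans k6).
rewrite [RHS]nth_default ?size_mkseq // nth_default // sm leqNgt; apply/negP => j6.
have : (i : nat) \in t by apply/mapP; exists (j : nat); rewrite ?mem_iota // /o inord_val sj.
by rewrite tmem mem_iota /= ltnNge i6.
Qed.
End Symmetry.

Lemma basis_generatorsE (R : realType) star : basis_generators R star =
  [seq (g.1%:R / 4, g.2) | g : nat * seq nat <- generators star].
Proof.
case: star; congr [:: (_, _); (_, _); (_, _); (_, _); (_, _); (_, _); (_, _); (_, _)];
 by rewrite /=; field.
Qed.

Section Final.
Context {R : realType}.
Variables (star : basis_name) (v1 v2 v3 : R * R).
Local Notation v := (split12 v1 v2 v3).
Local Notation D := (orient v1 v2 v3).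
Local Notation T := (triangle v).
Local Notation lambda := (@lebesgue_measure R).
Local Notation mu2 := (lambda \x lambda)%E.
Local Notation coords := (bary_coords v1 v2 v3).
Hypothesis D0 : D != 0.

Definition basis_function (k : 'I_39) (x : R * R) : R :=
  (nth_spline star k).1%:R / 4 * simplex_spline v (knots_of_seq (nth_spline star k).2) x.

Lemma nth_spline_knots k : size (nth_spline star k).2 = 6%N /\ sumn (nth_spline star k).2 = 8%N.
Proof.
have /allP/(_ (nth_spline star k)) := splines_knots star.
by rewrite mem_nth ?size_splines // => /(_ isT)/andP[/eqP -> /eqP ->].
Qed.

Lemma spline_basis_nth S : spline_basis star v1 v2 v3 S ->
  exists k, S = basis_function k.
Proof.
case=> [[w m] [s [/= + sym ->]]].
rewrite basis_generatorsE => /mapP[g gs [-> ->]].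
have [t ts ->] := symmetry_permute D0 sym; last first.
  by have : all (fun g : nat * seq nat => size g.2 == 6%N) (generators star);
     [case: star | move/allP => /(_ g gs)/eqP].
have gt : (g.1, permute t g.2) \in splines star.
  by rewrite mem_undup; apply/flattenP; exists [seq (g.1, permute t g.2) | t <- symmetries];
     apply/mapP; [exists g | exists t].
have k39 : (index (g.1, permute t g.2) (splines star) < 39)%N.
  by rewrite -(size_splines star) index_mem.
by exists (Ordinal k39); rewrite /basis_function /nth_spline /= nth_index.
Qed.

Lemma basis_value c x (a : 'I_39 -> R) : c \in cells -> open_cell c (coords x) ->
  T x -> generic v x ->
  \sum_k a k * basis_function k x = combination star c (coords x) a.
Proof.
move=> cc xc xT xg; apply: eq_bigr => k _; have [sk wk] := nth_spline_knots k.
by rewrite /basis_function (spline_value D0 cc xc xT xg sk wk).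
Qed.

(** Nonnegative functions with sum 1. *)
Lemma combination_le c b (a : 'I_39 -> R) (M : R) : c \in cells -> open_cell c b ->
  b.1.1 + b.1.2 + b.2 = 1 -> (forall k, `|a k| <= M) -> `|combination star c b a| <= M.
Proof.
move=> cc bc b1 aM; apply: le_trans (ler_norm_sum _ _ _) _.
have E : \sum_k ((nth_spline star k).1%:R / 4 * value b (around c) 5 (nth_spline star k).2) = 1.
  apply: (@mulfI _ 4); first by rewrite pnatr_eq0.
  rewrite mulr1 -[RHS](partition_of_unity star cc b1) (big_nth (0, [::])%N) size_splines big_mkord.
  rewrite mulr_sumr; apply: eq_bigr => k _; rewrite -/(nth_spline star k).
  by rewrite mulrA [4 * _]mulrC divfK // pnatr_eq0.
apply: (@le_trans _ _ (M * 1)); last by rewrite mulr1.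
rewrite -[X in M * X]E mulr_sumr; apply: ler_sum => k _.
have p0 : 0 <= (nth_spline star k).1%:R / 4 * value b (around c) 5 (nth_spline star k).2.
  by apply: mulr_ge0; [exact: divr_ge0 | exact: value_ge0].
by rewrite normrM (ger0_norm p0); apply: ler_wpM2r.
Qed.

Lemma open_cell_triangle c x : c \in cells -> open_cell c (coords x) -> T x.
Proof.
move=> cc xc; apply/(triangleP D0).
have h (l : vec3 Z) : all (fun c => all (fun g => 0 <= dot l g) (corners c)) cells ->
    0 <= dot (zr3 R l) (coords x).
  by move=> hl; apply: (cell_ge0 cc xc); exact: (allP hl c cc).
move: (h (Zpos 1, Z0, Z0) isT) (h (Z0, Zpos 1, Z0) isT) (h (Z0, Z0, Zpos 1) isT).
move: (coords x) => b; rewrite /dot /zr3 /= !zr1 !zr0 !mul1r !mul0r !addr0 !add0r.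
by move=> ? ? ?; split.
Qed.

Local Open Scope ereal_scope.

(** For a null plane the norm would be 0 by definition; this case has to be excluded. *)
Lemma Linfty_leP (f : R * R -> R) (M : R) : (0 <= M)%R ->
  Linfty_norm T f <= M%:E <-> {ae mu2, forall x, T x -> (`|f x| <= M)%R}.
Proof.
move=> M0.
have patch x : `|((f \_ T) x)%:E| <= M%:E <-> (T x -> (`|f x| <= M)%R).
  rewrite /= lee_fin patchE; have [xT|xT] := pselect (T x).
    by rewrite mem_set //; split => // h; exact: h.
  by rewrite memNset // normr0 M0; split.
have -> : {ae mu2, forall x, T x -> (`|f x| <= M)%R} =
    {ae mu2, forall x, (abse \o (EFin \o (f \_ T))) x <= M%:E}.
  by congr almost_everywhere; apply/funext => x; apply/propext; rewrite patch.
rewrite /Linfty_norm unlock; case: ifPn => [_|].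
  by split => [/ess_supP //|h]; exact/ess_supP.
move/negP; case; apply: lt_le_trans (mu2_unit_triangle_gt0) _; exact: le_mu2.
Qed.

Lemma upper_bound (a : 'I_39 -> R) (M : R) : (0 <= M)%R -> (forall k, (`|a k| <= M)%R) ->
  Linfty_norm T (fun x => \sum_k (a k * basis_function k x)%R)%R <= M%:E.
Proof.
move=> M0 aM; apply/(Linfty_leP _ M0).
apply: negligibleS (ae_generic v1 v2 v3) => x /=; apply: contra_not => xg xT.
have [c cc xc] := generic_cell D0 xT xg.
by rewrite (basis_value _ cc xc xT xg); apply: combination_le => //; exact: coords_sum.
Qed.

(** If the polynomial exceeded M at b, it would do so on a neighbourhood, whose generic
points form a set that is not null. *)
Lemma combination_le_norm (a : 'I_39 -> R) (M : R) c b : (0 <= M)%R ->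
  Linfty_norm T (fun x => \sum_k (a k * basis_function k x)%R)%R <= M%:E ->
  c \in cells -> open_cell c b -> (b.1.1 + b.1.2 + b.2 = 1)%R ->
  (`|combination star c b a| <= M)%R.
Proof.
move=> M0 /(Linfty_leP _ M0) fM cc bc b1; rewrite leNgt; apply/negP => Mb.
pose x := (b.1.1 *: v1 + b.1.2 *: v2 + b.2 *: v3)%R.
have xb : coords x = b by rewrite (coords_comb D0 b1 erefl); case: (b) => -[].
pose g y := combination star c (coords y) a.
have gc : g y @[y --> x] --> g x.
  rewrite /g /combination; elim: (index_enum _) => [|k s IH].
    by under eq_fun do rewrite big_nil; rewrite ?big_nil; exact: cvg_cst.
  under eq_fun do rewrite big_cons; rewrite ?big_cons.
  apply: cvgD => //; apply: cvgM; first exact: cvg_cst.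
  by apply: cvgM; [exact: cvg_cst | exact: value_continuous].
have U : \forall y \near x, open_cell c (coords y) /\ (M < `|g y|)%R.
  apply: filterI; first by apply: near_open_cell; rewrite xb.
  have Mg : (M < `|g x|)%R by rewrite /g xb.
  have hc : `|g y|%R @[y --> x] --> `|g x|%R by exact: cvg_norm.
  exact: (cvgr_gt _ hc _ Mg).
apply: (nbhs_non_negligible U).
apply: negligibleS (negligibleU fM (ae_generic v1 v2 v3)) => y /= [yc My].
have yT := open_cell_triangle cc yc.
have [yg|yg] := pselect (generic v y); [left => /(_ yT) | by right].
by rewrite (basis_value _ cc yc yT yg) leNgt My.
Qed.
End Final.

Theorem theorem8 (R : realType) (star : basis_name) :
  exists2 K : R, 0 < K &
    forall v1 v2 v3 : R * R,
      let T := triangle (split12 v1 v2 v3) in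
      area T != 0 ->
    forall S : 'I_39 -> (R * R -> R),
      injective S -> range S = spline_basis star v1 v2 v3 ->
    forall c : 'cV[R]_39,
      let f := fun x => \sum_i c i ord0 * S i x in
      ((K^-1 * `|c|)%:E <= Linfty_norm T f)%E /\
      (Linfty_norm T f <= `|c|%:E)%E.
Proof.
have [K K0 hK] := @stability R star; exists K => // v1 v2 v3 T /orient_neq0 D0 S Sinj SE c f.
have /choice[pi piE] : forall i, exists k, S i = basis_function star v1 v2 v3 k.
  by move=> i; apply: spline_basis_nth => //; rewrite -SE; exists i.
have pi_inj : injective pi by move=> i j ij; apply: Sinj; rewrite !piE ij.
have [rho piK rhoK] := injF_bij pi_inj.
pose a k := c (rho k) ord0.
have fE : f = fun x => \sum_k a k * basis_function star v1 v2 v3 k x.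
  apply/funext => x; rewrite /f (reindex rho); last by exists pi => i _.
  by apply: eq_bigr => k _; rewrite piE rhoK.
have aM k : `|a k| <= `|c|.
  rewrite [leRHS]/Num.norm /= mx_normrE.
  by apply/bigmax_geP; right; exists (rho k, ord0).
have upper := upper_bound star D0 (normr_ge0 c) aM.
rewrite fE; split=> //.
set N := Linfty_norm T _ in upper *.
have N0 : (0 <= N)%E by rewrite /N /Linfty_norm; exact: Lnorm_ge0.
have NE : N = (fine N)%:E by rewrite fineK // ge0_fin_numE // (le_lt_trans upper) ?ltry.
have M0 : 0 <= fine N by exact: fine_ge0.
have small := hK a (fine N) M0.
rewrite NE lee_fin ler_pdivrMl //.
have cM : forall k, `|a k| <= K * fine N.
  by apply: small => cl b cc bc b1; apply: (combination_le_norm D0 M0) => //; rewrite -NE.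
rewrite [leLHS]/Num.norm /= mx_normrE; apply: bigmax_le; first by rewrite mulr_ge0 // ltW.
move=> [i j] _ /=; rewrite (ord1 j) -[i]piK; exact: cM.
Qed.
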